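(* Let $A$ be a finite alphabet and let $\mathtt a,\mathtt b\in A$ be two distinct letters. The existential theory of word equations over $A^*$ is undecidable when augmented with both the predicates $Eq_{\mathtt a}$ and $Eq_{\mathtt b}$.
   Context: A word equation is a formal equality $U=V$ where $U,V$ are words over constants from $A$ and variables ranging over $A^*$; an assignment (extended to a morphism fixing $A$) satisfies it if the images of $U$ and $V$ coincide. The existential theory of word equations augmented with given predicates consists of the sentences $\exists x_1,\ldots,x_n.\phi$, with $\phi$ a quantifier-free Boolean combination of word equations and atoms built from these predicates; it is undecidable if there is no algorithm deciding the truth of such sentences in $A^*$. $Eq_{\mathtt a}(x,y)$ is true iff $|x|_{\mathtt a}=|y|_{\mathtt a}$, and $Eq_{\mathtt b}(x,y)$ is true iff $|x|_{\mathtt b}=|y|_{\mathtt b}$, where $|w|_c$ is the number of occurrences of the letter $c$ in $w$. *)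

(* Defs.v *)
From mathcomp Require Import all_boot.
From Stdlib Require Cantor.

Set Implicit Arguments.
Unset Strict Implicit.
Unset Printing Implicit Defensive.

(** Algorithms are taken to be the partial mu-recursive functions on [nat]. *)
Inductive recfun : nat -> Type :=
| Zero n : recfun n
| Succ : recfun 1
| Proj n (i : 'I_n) : recfun n
| Comp m n (f : recfun m) (g : 'I_m -> recfun n) : recfun n
| PrimRec n (f : recfun n) (g : recfun n.+2) : recfun n.+1
| Mu n (f : recfun n.+1) : recfun n.

(** [computes f v y]: the partial function denoted by [f] is defined at [v],
    with value [y].  In [PrimRec f g] the recursion argument is the first one
    and [g] receives the counter, the previous value and the parameters. *)
Fixpoint computes n (f : recfun n) : n.-tuple nat -> nat -> Prop :=
  match f in recfun n return n.-tuple nat -> nat -> Prop with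
  | Zero _ => fun _ y => y = 0
  | Succ => fun v y => y = (thead v).+1
  | Proj _ i => fun v y => y = tnth v i
  | Comp m _ f g => fun v y =>
      exists w : m.-tuple nat,
        (forall i, computes (g i) v (tnth w i)) /\ computes f w y
  | PrimRec _ f g => fun v y =>
      let p := behead_tuple v in
      (fix rec k y := match k with
         | 0 => computes f p y
         | k'.+1 => exists z, rec k' z /\ computes g [tuple of k' :: z :: p] y
         end) (thead v) y
  | Mu _ f => fun v y =>
      computes f [tuple of y :: v] 0 /\
      forall z, z < y -> exists k, computes f [tuple of z :: v] k.+1
  end.

(** The algorithm has to answer only on codes of elements of [T]. *)
Definition algorithmically_decidable T (code : T -> nat) (P : T -> Prop) :=
  exists f : recfun 1, forall t : T,
    (P t -> computes f [tuple code t] 1) /\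
    (~ P t -> computes f [tuple code t] 0).

(** [inl i] is the variable [x_i], [inr c] the constant letter [c]. *)
Definition term (A : finType) (n : nat) := seq ('I_n + A).

Inductive formula (A : finType) (n : nat) :=
| WordEq of term A n & term A n
| EqA of term A n & term A n
| EqB of term A n & term A n
| Not of formula A n
| And of formula A n & formula A n
| Or of formula A n & formula A n.

(** The closed sentence [exists x_0 ... x_(nvars-1), matrix]. *)
Record sentence (A : finType) :=
  Sentence { nvars : nat; matrix : formula A nvars }.

Section Semantics.
Variables (A : finType) (a b : A).

Definition extend n (s : 'I_n -> seq A) (u : term A n) : seq A :=
  flatten [seq match z with inl i => s i | inr c => [:: c] end | z <- u].

Definition eq_count (c : A) (x y : seq A) : bool :=
  count_mem c x == count_mem c y.

Fixpoint sat n (s : 'I_n -> seq A) (phi : formula A n) : bool :=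
  match phi with
  | WordEq u v => extend s u == extend s v
  | EqA u v => eq_count a (extend s u) (extend s v)
  | EqB u v => eq_count b (extend s u) (extend s v)
  | Not p => ~~ sat s p
  | And p q => sat s p && sat s q
  | Or p q => sat s p || sat s q
  end.

Definition holds (phi : sentence A) : Prop :=
  exists s : 'I_(nvars phi) -> seq A, sat s (matrix phi).

End Semantics.

(** An explicit injective Goedel numbering, via the Cantor pairing; letters are
    numbered by their rank in the finite alphabet. *)
Definition pair_code (x y : nat) : nat := Cantor.to_nat (x, y).

Definition seq_code (s : seq nat) : nat :=
  foldr (fun x r => (pair_code x r).+1) 0 s.

Section Coding.
Variable A : finType.

Definition symbol_code n (z : 'I_n + A) : nat :=
  match z with
  | inl i => pair_code 0 i
  | inr c => pair_code 1 (enum_rank c)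
  end.

Definition term_code n (u : term A n) : nat :=
  seq_code [seq symbol_code z | z <- u].

Fixpoint formula_code n (phi : formula A n) : nat :=
  match phi with
  | WordEq u v => pair_code 0 (pair_code (term_code u) (term_code v))
  | EqA u v => pair_code 1 (pair_code (term_code u) (term_code v))
  | EqB u v => pair_code 2 (pair_code (term_code u) (term_code v))
  | Not p => pair_code 3 (formula_code p)
  | And p q => pair_code 4 (pair_code (formula_code p) (formula_code q))
  | Or p q => pair_code 5 (pair_code (formula_code p) (formula_code q))
  end.

Definition sentence_code (phi : sentence A) : nat :=
  pair_code (nvars phi) (formula_code (matrix phi)).

Lemma pair_code_inj x y x' y' :
  pair_code x y = pair_code x' y' -> x = x' /\ y = y'.
Proof. by move=> /Cantor.to_nat_inj [-> ->]. Qed.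

Lemma seq_code_inj : injective seq_code.
Proof.
elim=> [|x s IHs] [|y t] //= [] /pair_code_inj[-> /IHs ->]; done.
Qed.

Lemma term_code_inj n : injective (@term_code n).
Proof.
move=> u v /seq_code_inj; apply: inj_map => -[i|c] [j|d] /= /pair_code_inj[] //.
  by move=> _ /val_inj ->.
by move=> _ /val_inj/enum_rank_inj ->.
Qed.

Lemma formula_code_inj n : injective (@formula_code n).
Proof.
elim=> [u v|u v|u v|p IHp|p IHp q IHq|p IHp q IHq]
       [u' v'|u' v'|u' v'|p'|p' q'|p' q'] /= /pair_code_inj[] // _.
- by move=> /pair_code_inj[/term_code_inj-> /term_code_inj->].
- by move=> /pair_code_inj[/term_code_inj-> /term_code_inj->].
- by move=> /pair_code_inj[/term_code_inj-> /term_code_inj->].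
- by move=> /IHp->.
- by move=> /pair_code_inj[/IHp-> /IHq->].
- by move=> /pair_code_inj[/IHp-> /IHq->].
Qed.

Lemma sentence_code_inj : injective sentence_code.
Proof.
move=> [n p] [m q] /pair_code_inj[/= enm]; rewrite -{}enm in q *.
by move=> /formula_code_inj->.
Qed.

End Coding.

(* Main.v *)
(* Read a word as the number of its letters [a].  Concatenation is then addition,
   and multiplication is expressible because commuting words have proportional
   letter counts: if [w] commutes with [x b], where [b] does not occur in [x],
   then [|w|_a = |x|_a |w|_b], while the words commuting with [a b] convert counts
   of [b] into counts of [a].  So every Diophantine relation is defined by an
   existential sentence, and a decision procedure for the sentences would decide
   all Diophantine relations.

   The graph of every mu-recursive function is Diophantine (Matiyasevich): the
   sequence [u(n+2) = b u(n+1) - u(n)] has a Diophantine graph, which yields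
   exponentiation, then binomial coefficients, factorials and the products of
   the [1 + (i+1) t]; the Chinese remainder theorem then eliminates bounded
   universal quantifiers, hence also primitive recursion and minimisation.

   Given a decision procedure [D], let [R n e] say that [D] rejects the sentence
   obtained by plugging [n] and [e] into the formula in [n] variables with code
   [e].  Some formula defines [R], and plugging its own number of variables and
   code into it contradicts the correctness of [D]. *)

From Stdlib Require Import FunctionalExtensionality.
From Stdlib Require Import ZArith Znumtheory Zpow_facts Lia.
Require Import Defs.
From mathcomp Require Import all_boot.
From mathcomp Require Import zify_ssreflect.

Set Implicit Arguments.
Unset Strict Implicit.
Unset Printing Implicit Defensive.

Local Open Scope nat_scope.

(** * Lucas sequences *)

Section Lucas.
Local Open Scope Z_scope.

Fixpoint lucas_pair (b : Z) (n : nat) : Z * Z :=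
  if n is m.+1 then
    let: (x, y) := lucas_pair b m in (y, b * y - x)
  else (0, 1).

Definition lucas b n := (lucas_pair b n).1.

Lemma lucas0 b : lucas b 0 = 0. Proof. by []. Qed.
Lemma lucas1 b : lucas b 1 = 1. Proof. by []. Qed.

Lemma lucasSS b n : lucas b n.+2 = b * lucas b n.+1 - lucas b n.
Proof. by rewrite /lucas /=; case: (lucas_pair b n). Qed.

Lemma lucas_ge0_lt b n : 2 <= b -> 0 <= lucas b n < lucas b n.+1.
Proof.
move=> hb; elim: n => [|n IH]; first by rewrite lucas0 lucas1; lia.
rewrite lucasSS; nia.
Qed.

Lemma lucas_ge0 b n : 2 <= b -> 0 <= lucas b n.
Proof. by move=> /(@lucas_ge0_lt b n); lia. Qed.

Lemma lucas_le b m n : 2 <= b -> (m <= n)%N -> lucas b m <= lucas b n.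
Proof.
move=> hb; elim: n => [|n IH]; first by rewrite leqn0 => /eqP->; lia.
rewrite leq_eqVlt => /orP[/eqP->|]; first lia.
by rewrite ltnS => /IH; have := @lucas_ge0_lt b n hb; lia.
Qed.

Lemma lucas_lt b m n : 2 <= b -> (m < n)%N -> lucas b m < lucas b n.
Proof.
move=> hb /(@lucas_le b m.+1 n hb); have := @lucas_ge0_lt b m hb; lia.
Qed.

Lemma lucas_ge_id b n : 2 <= b -> Z.of_nat n <= lucas b n.
Proof.
move=> hb; elim: n => [|n IH]; first by rewrite lucas0.
have := @lucas_ge0_lt b n hb; lia.
Qed.

Lemma lucas_ge_pow b n : 2 <= b -> (b - 1) ^ Z.of_nat n <= lucas b n.+1.
Proof.
move=> hb; elim: n => [|n IH]; first by rewrite lucas1.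
rewrite Nat2Z.inj_succ Z.pow_succ_r ?lucasSS; last lia.
have := @lucas_ge0_lt b n hb; nia.
Qed.

(** The form [x^2 - b x y + y^2] is invariant under [(x, y) -> (y, b y - x)] and equals 1 at
    [(0, 1)]. *)
Lemma lucas_norm b n :
  lucas b n * lucas b n - b * lucas b n * lucas b n.+1
    + lucas b n.+1 * lucas b n.+1 = 1.
Proof.
elim: n => [|n <-]; first by rewrite lucas0 lucas1; lia.
rewrite lucasSS; ring.
Qed.

(* Descent: (x, y) comes from the smaller solution (b x - y, x). *)
Lemma lucas_of_norm b x y : 2 <= b -> 0 <= x < y ->
  x * x - b * x * y + y * y = 1 ->
  exists n, x = lucas b n /\ y = lucas b n.+1.
Proof.
move=> hb [x0]; move: y; pattern x; apply: (Zlt_0_ind _ _ x x0) => {x0}x IH x0 y xy h.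
have [x00|xp] : x = 0 \/ 0 < x by lia.
  by exists 0%N; rewrite lucas0 lucas1; subst x; nia.
have hge : 0 <= b * x - y by nia.
have hlt : b * x - y < x by nia.
have [|n [e1 e2]] := IH (b * x - y) (conj hge hlt) x hlt.
  by rewrite -h; ring.
by exists n.+1; split=> //; rewrite lucasSS -e1 -e2; ring.
Qed.

Lemma lucas_of_norm_sym b x y : 3 <= b -> 0 <= x -> 0 <= y ->
  x * x - b * x * y + y * y = 1 -> exists n, x = lucas b n.
Proof.
move=> hb x0 y0 h; have [xy|[xy|xy]] : x < y \/ y < x \/ x = y by lia.
- have [||//|n [-> _]] := @lucas_of_norm b x y; [lia|lia|by exists n].
- have [|||n [_ ->]] := @lucas_of_norm b y x; [lia|lia| |by exists n.+1].
  by rewrite -h; ring.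
(* Here [(2 - b) x^2 = 1], impossible for [3 <= b]. *)
- by subst y; nia.
Qed.

(** A term is an integer polynomial in its parameter. Since [lucas 2 n = n], the case [b = 2] lets
    the index be read off modulo [w - 2]. *)
Lemma lucas_congr b w n : (w - b | lucas w n - lucas b n).
Proof.
suff [] : (w - b | lucas w n - lucas b n) /\ (w - b | lucas w n.+1 - lucas b n.+1) by [].
elim: n => [|n [[k hk] [l hl]]]; first by split; exists 0.
split; first by exists l.
exists (lucas w n.+1 + b * l - k).
rewrite !lucasSS.
transitivity ((w - b) * lucas w n.+1 + b * (lucas w n.+1 - lucas b n.+1)
  - (lucas w n - lucas b n)); first ring.
by rewrite hk hl; ring.
Qed.

Lemma lucas_2 n : lucas 2 n = Z.of_nat n.
Proof.
suff [] : lucas 2 n = Z.of_nat n /\ lucas 2 n.+1 = Z.of_nat n.+1 by [].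
by elim: n => [|n [h1 h2]] //; split=> //; rewrite lucasSS h1 h2; lia.
Qed.

(** * Addition formulas and divisibility between terms *)

Lemma lucas_addS b m n :
  lucas b (m + n).+1 = lucas b m.+1 * lucas b n.+1 - lucas b m * lucas b n /\
  lucas b (m + n) = lucas b m.+1 * lucas b n + lucas b m * lucas b n.+1
                    - b * lucas b m * lucas b n.
Proof.
elim: n => [|n [h1 h2]].
  by rewrite addn0 lucas0 lucas1; split; ring.
rewrite addnS lucasSS h1 h2 !lucasSS; split; ring.
Qed.

Lemma lucas_sub b m n :
  lucas b n = lucas b (m + n) * lucas b m.+1 - lucas b (m + n).+1 * lucas b m.
Proof.
elim: m => [|m IH]; first by rewrite add0n lucas0 lucas1; ring.
by rewrite addSn !lucasSS {1}IH; ring.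
Qed.

Lemma lucas_coprime b n : rel_prime (lucas b n) (lucas b n.+1).
Proof.
apply: bezout_rel_prime; have := lucas_norm b n => h.
apply: (Bezout_intro _ _ _ (lucas b n - b * lucas b n.+1) (lucas b n.+1)).
rewrite -h; ring.
Qed.

(** Expansion to first order in [u = lucas b k]: with [g = lucas b k.+1], modulo [u^2] the term at
    [k l] is [l g^(l-1) u]. Multiplying by [g] avoids the exponent [l - 1]. *)
Lemma lucas_mul_congr b k l :
  exists j, [/\ lucas b (k * l) = lucas b k * j,
    (lucas b k | lucas b (k * l).+1 - lucas b k.+1 ^ Z.of_nat l) &
    (lucas b k | lucas b k.+1 * j - Z.of_nat l * lucas b k.+1 ^ Z.of_nat l)].
Proof.
set u := lucas b k; set g := lucas b k.+1.
elim: l => [|l [j [h1 [x hx] [y hy]]]].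
  by exists 0; rewrite muln0 lucas0 lucas1; split; [ring|exists 0|exists 0; ring].
exists (lucas b (k * l).+1 + g * j - b * u * j).
have [e1 e2] := lucas_addS b (k * l) k.
rewrite mulnS addnC e1 e2 h1 -/u -/g Nat2Z.inj_succ Z.pow_succ_r; last lia.
split; first ring.
  exists (g * x - j * u).
  have -> : lucas b (k * l).+1 = x * u + g ^ Z.of_nat l by lia.
  ring.
exists (g * x + g * y - g * b * j).
have e3 : lucas b (k * l).+1 = x * u + g ^ Z.of_nat l by lia.
rewrite e3.
transitivity (g * x * u + g * (g * j - Z.of_nat l * g ^ Z.of_nat l)
  - g * b * u * j); first by rewrite /Z.succ; ring.
rewrite hy; ring.
Qed.

Lemma rel_prime_lucas_pow b k l :
  rel_prime (lucas b k) (lucas b k.+1 ^ Z.of_nat l).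
Proof. apply: rel_prime_Zpower_r; [lia|exact: lucas_coprime]. Qed.

(** For [m = k l + r] the term at [m] is [g^l * lucas b r] modulo [lucas b k], with [g] coprime to
    [lucas b k]. So [lucas b k] divides the smaller [lucas b r], which forces [r = 0]. *)
Lemma lucas_dvd_index b k m : 2 <= b -> (0 < k)%N ->
  (lucas b k | lucas b m) -> (k %| m)%N.
Proof.
move=> hb k0.
have [l [r [-> rk]]] : exists l r, m = (k * l + r)%N /\ (r < k)%N.
  by exists (m %/ k)%N, (m %% k)%N; rewrite mulnC -divn_eq ltn_mod.
have [_ ->] := lucas_addS b (k * l) r.
have [j [-> [x hx] _]] := lucas_mul_congr b k l.
move=> [y hy].
have : (lucas b k | lucas b k.+1 ^ Z.of_nat l * lucas b r).
  exists (y - x * lucas b r - j * lucas b r.+1 + b * j * lucas b r).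
  have -> : lucas b k.+1 ^ Z.of_nat l =
    lucas b (k * l).+1 - x * lucas b k by lia.
  rewrite !Z.mul_sub_distr_r Z.mul_add_distr_r Z.mul_sub_distr_r.
  by rewrite Z.mul_sub_distr_r -hy; ring.
move=> /Gauss /(_ (rel_prime_lucas_pow b k _)) [z hz].
have := @lucas_lt b _ _ hb rk; have := @lucas_ge0 b r hb.
have := @lucas_ge_id b r hb => h1 h2 h3.
have z0 : z = 0 by nia.
have -> : r = 0%N by subst z; lia.
by rewrite addn0 dvdn_mulr.
Qed.

(** Here [m = k l] and the cofactor [j] of [lucas_mul_congr] is divisible by [lucas b k]; cancelling
    the power of [g] leaves [lucas b k] dividing [l]. *)
Lemma lucas_sqr_dvd b k m : 2 <= b -> (0 < k)%N ->
  (lucas b k * lucas b k | lucas b m) -> (lucas b k | Z.of_nat m).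
Proof.
move=> hb k0 hd.
have u0 : 0 < lucas b k by have := @lucas_lt b _ _ hb k0; rewrite lucas0.
have /dvdnP[l e] : (k %| m)%N.
  apply: (lucas_dvd_index hb k0); apply: Z.divide_trans hd; exists (lucas b k); ring.
have [j [h1 _ h3]] := lucas_mul_congr b k l.
rewrite {m}e mulnC h1 in hd *.
have {}hd : (lucas b k | j).
  by case: hd => x hx; exists x; apply: (Z.mul_reg_l _ _ (lucas b k)); lia.
have : (lucas b k | lucas b k.+1 ^ Z.of_nat l * Z.of_nat l).
  case: hd => x hx; case: h3 => y hy; exists (lucas b k.+1 * x - y).
  by rewrite hx in hy; lia.
move=> /Gauss /(_ (rel_prime_lucas_pow b k _)) [x hx].
exists (Z.of_nat k * x); rewrite Nat2Z.inj_mul hx; ring.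
Qed.

Lemma sqr_dvd_lucas b k : 2 <= b -> (0 < k)%N ->
  (lucas b k * lucas b k | lucas b (k * Z.to_nat (lucas b k))).
Proof.
move=> hb k0.
have u0 : 0 <= lucas b k by exact: lucas_ge0.
have [j [-> _ h3]] := lucas_mul_congr b k (Z.to_nat (lucas b k)).
apply: Z.mul_divide_mono_l.
apply: (Gauss _ (lucas b k.+1)); last exact: lucas_coprime.
case: h3 => y; rewrite Z2Nat.id // => hy.
exists (y + lucas b k.+1 ^ lucas b k); lia.
Qed.

(** * Terms modulo [2 * lucas b m.+1 - b * lucas b m] *)

Lemma lucas_double b m n :
  lucas b (m + (m + n)) + lucas b n =
  (2 * lucas b m.+1 - b * lucas b m) * lucas b (m + n).
Proof.
by have [_ ->] := lucas_addS b m (m + n); rewrite (lucas_sub b m n); ring.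
Qed.

Lemma lucas_reflect b m i : (i <= m)%N ->
  lucas b (m + i) - lucas b (m - i) =
  (2 * lucas b m.+1 - b * lucas b m) * lucas b i.
Proof.
move=> im; have [_ ->] := lucas_addS b m i.
by rewrite (lucas_sub b i (m - i)) subnKC //; ring.
Qed.

(** Modulo [v], [lucas_reflect] folds the index [m + i] onto [m - i], and [lucas_double] removes
    [2 m] at the cost of a sign. Both moves keep the index modulo [m] up to sign. *)
Lemma lucas_mod_reduce b m n : (0 < m)%N ->
  let v := 2 * lucas b m.+1 - b * lucas b m in
  exists j, [/\ (j <= m)%N,
    (v | lucas b n - lucas b j) \/ (v | lucas b n + lucas b j) &
    (Z.of_nat m | Z.of_nat n - Z.of_nat j) \/
    (Z.of_nat m | Z.of_nat n + Z.of_nat j)].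
Proof.
move=> m0 v; elim/ltn_ind: n => n IH.
have [nm|mn] := leqP n m.
  by exists n; split=> //; left; exists 0; lia.
have [n2|n2] := leqP n (m + m).
  have im : (n - m <= m)%N by lia.
  exists (m - (n - m))%N; split; first lia.
    left; exists (lucas b (n - m)); have := lucas_reflect b im.
    by rewrite subnKC => [->|]; [rewrite /v; ring|lia].
  by right; exists 2; lia.
have [|j [jm h1 h2]] := IH (n - (m + m))%N; first lia.
exists j; split=> //.
  have e : lucas b n + lucas b (n - (m + m)) = v * lucas b (n - m).
    have := lucas_double b m (n - (m + m)).
    have -> : (m + (m + (n - (m + m))) = n)%N by lia.
    by have -> : (m + (n - (m + m)) = n - m)%N by lia.
  by case: h1 => -[x hx]; [right|left]; exists (lucas b (n - m) - x); lia.
by case: h2 => -[x hx]; [left|right]; exists (x + 2); lia.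
Qed.

(** The norm equations make [u], [s] and [x] Lucas terms, [x] at some index [n] with parameter [w].
    Modulo [v], [x] is [lucas b n], which reduces to a small index [j] with [a = lucas b j]. Modulo
    [u], which divides the index of [s], [x] is [n], hence [j] up to sign, so [c = j]. *)
Lemma lucas_sound b a c u t s r v w x y :
  3 < b -> 0 <= a -> 0 <= c -> 0 <= u -> 0 <= t -> 0 <= r < s ->
  2 < w -> 0 <= x -> 0 <= y ->
  u * u - b * u * t + t * t = 1 -> s * s - b * s * r + r * r = 1 ->
  (u * u | s) -> v = b * s - 2 * r -> (v | w - b) -> (u | w - 2) ->
  x * x - w * x * y + y * y = 1 -> 2 * a < u -> 2 * a < v -> (v | a - x) ->
  2 * c < u -> (u | c - x) -> a = lucas b (Z.to_nat c).
Proof.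
move=> hb a0 c0 u0 t0 rs w2 x0 y0 hu hs us hv vw uw hx au av vax cu ucx.
have [k hk] : exists n, u = lucas b n by apply: (@lucas_of_norm_sym b u t); lia.
have [m [hr hm]] : exists n, r = lucas b n /\ s = lucas b n.+1.
  by apply: lucas_of_norm; lia.
have [n hn] : exists n, x = lucas w n by apply: (@lucas_of_norm_sym w x y); lia.
have k0 : (0 < k)%N by case: k hk => // hk; rewrite lucas0 in hk; lia.
have um : (u | Z.of_nat m.+1).
  by rewrite hk; apply: lucas_sqr_dvd => //; [lia|rewrite -hk -hm].
have [j [jm h1 h2]] := @lucas_mod_reduce b m.+1 n isT.
have ev : 2 * lucas b m.+2 - b * lucas b m.+1 = v.
  by rewrite lucasSS -hr -hm hv; ring.
rewrite ev in h1.
have vbx : (v | lucas b n - x).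
  case: vw => p hp; have [q hq] := lucas_congr b w n.
  by exists (- q * p); rewrite hn; rewrite hp in hq; lia.
have js : 0 <= lucas b j <= s.
  by split; [apply: lucas_ge0; lia|rewrite hm; apply: lucas_le; [lia|]].
have vs : 2 * s < v by nia.
(* Numbers below half the modulus are determined by their residue up to sign. *)
have small z d e f : 0 <= 2 * d < z -> 0 <= 2 * e < z ->
    (z | d - f) -> f = e \/ f = - e -> d = e.
  move=> hd he [p hp] hf; have p0 : p = 0 by nia.
  by subst p; lia.
have aj : a = lucas b j.
  have [hp|hp] : (v | a - lucas b j) \/ (v | a - - lucas b j).
  - case: vax => p hp; case: vbx => q hq.
    by case: h1 => -[z hz]; [left; exists (p - q + z)|right; exists (p - q + z)]; lia.
  - by apply: (small v _ _ _ _ _ hp); lia.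
  - by apply: (small v _ _ _ _ _ hp); lia.
have jj : Z.of_nat j <= a by rewrite aj; apply: lucas_ge_id; lia.
have ucn : (u | c - Z.of_nat n).
  case: uw => p hp; have := lucas_congr 2 w n; rewrite lucas_2 -hn => -[q hq].
  case: ucx => z hz; exists (z + q * p); rewrite hp in hq; lia.
suff -> : c = Z.of_nat j by rewrite Nat2Z.id.
have [hp|hp] : (u | c - Z.of_nat j) \/ (u | c - - Z.of_nat j).
- case: um => p hp; case: ucn => q hq.
  by case: h2 => -[z hz]; [left|right]; exists (q + z * p); nia.
- by apply: (small u _ _ _ _ _ hp); lia.
- by apply: (small u _ _ _ _ _ hp); lia.
Qed.

(** Two consecutive even terms would make the norm even. An odd [u] serves the coprimality of [u]
    and [v] in [lucas_complete], where [v] is [-2 r] modulo [u]. *)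
Lemma lucas_odd b n : 2 <= b -> exists2 k, (n <= k)%N & rel_prime (lucas b k) 2.
Proof.
move=> hb.
have odd2 x : x mod 2 = 1 -> rel_prime x 2.
  move=> hx; apply: bezout_rel_prime; apply: (Bezout_intro _ _ _ 1 (- (x / 2))).
  by have := Z.div_mod x 2; lia.
have hm x : x mod 2 = 0 \/ x mod 2 = 1 by have := Z.mod_pos_bound x 2; lia.
have [h1|/odd2 h1] := hm (lucas b n); last by exists n.
have [h2|/odd2 h2] := hm (lucas b n.+1); last by exists n.+1.
have := lucas_norm b n.
have -> : lucas b n = 2 * (lucas b n / 2).
  by have := Z.div_mod (lucas b n) 2; lia.
have -> : lucas b n.+1 = 2 * (lucas b n.+1 / 2).
  by have := Z.div_mod (lucas b n.+1) 2; lia.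
nia.
Qed.

Lemma lucas_complete b c : 3 < b ->
  exists u t s r v w x y,
  [/\ 0 <= u, 0 <= t, 0 <= r < s, 2 < w & 0 <= x] /\ 0 <= y /\
  [/\ u * u - b * u * t + t * t = 1, s * s - b * s * r + r * r = 1 & (u * u | s)] /\
  [/\ v = b * s - 2 * r, (v | w - b), (u | w - 2) & x * x - w * x * y + y * y = 1] /\
  [/\ 2 * lucas b c < u, 2 * lucas b c < v, (v | lucas b c - x),
      2 * Z.of_nat c < u & (u | Z.of_nat c - x)].
Proof.
move=> hb; have hb2 : 2 <= b by lia.
have c0 := @lucas_ge0 b c hb2.
have [k hk ku] := lucas_odd (2 * Z.to_nat (lucas b c) + 2 * c + 1) hb2.
have kbig := @lucas_ge_id b k hb2.
have k0 : (0 < k)%N by lia.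
set u := lucas b k in ku kbig.
(* The index [k u] is chosen for [s] so that [u^2] divides [s]. *)
have [m hm] : exists m, (k * Z.to_nat u = m.+1)%N.
  by exists (k * Z.to_nat u).-1; nia.
set s := lucas b m.+1; set r := lucas b m.
have us : (u * u | s) by rewrite /s -hm; apply: sqr_dvd_lucas.
have rs : 0 <= r < s by apply: lucas_ge0_lt.
set v := b * s - 2 * r.
have uv : rel_prime u v.
  have sr : rel_prime u r.
    apply: (rel_prime_div s r u).
      by apply: rel_prime_sym; exact: lucas_coprime.
    by apply: Z.divide_trans us; exists u; ring.
  have [z hz] : (u | s) by apply: Z.divide_trans us; exists u; ring.
  have [p q hpq] := rel_prime_bezout _ _ (rel_prime_mult u 2 r ku sr).
  apply: bezout_rel_prime; apply: (Bezout_intro _ _ _ (p + q * b * z) (- q)).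
  by rewrite /v -hpq hz; ring.
have [p q hpq] := rel_prime_bezout _ _ uv.
have v2s : 2 * s < v by rewrite /v; nia.
have u1 : 1 <= u by lia.
have su : u <= s.
  case: us => z hz; have z1 : 1 <= z by nia.
  by nia.
(* Chinese remaindering: [w0] is 2 modulo [u] and [b] modulo [v], because [p u + q v = 1]. A
   multiple of [u v] then makes it exceed 2. *)
set w0 := 2 + (b - 2) * p * u.
set w := w0 + (Z.abs w0 + 3) * u * v.
have w2 : 2 < w.
  have huv : 1 <= u * v by nia.
  have : (Z.abs w0 + 3) * 1 <= (Z.abs w0 + 3) * (u * v).
    by apply: Z.mul_le_mono_nonneg_l; lia.
  by rewrite /w -Z.mul_assoc; lia.
have vw : (v | w - b).
  exists (- (b - 2) * q + (Z.abs w0 + 3) * u).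
  have pu : p * u = 1 - q * v by lia.
  by rewrite /w {1}/w0 -(Z.mul_assoc (b - 2)) pu; ring.
have uw : (u | w - 2).
  exists ((b - 2) * p + (Z.abs w0 + 3) * v).
  by rewrite /w {1}/w0; ring.
exists u, (lucas b k.+1), s, r, v, w, (lucas w c), (lucas w c.+1).
split; first by split=> //; [lia|apply: lucas_ge0|apply: lucas_ge0; lia].
split; first by apply: lucas_ge0; lia.
split.
  split=> //; first exact: lucas_norm.
  by have := lucas_norm b m; rewrite -/s -/r; lia.
split; first by split=> //; exact: lucas_norm.
split; [lia|lia| |lia|].
- case: vw => z hz; have [z' hz'] := lucas_congr b w c.
  by exists (- z' * z); rewrite hz in hz'; lia.
- case: uw => z hz; have := lucas_congr 2 w c; rewrite lucas_2 => -[z' hz'].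
  by exists (- z' * z); rewrite hz in hz'; lia.
Qed.

(** The modulus is [-(q^2 - b q + 1)], so [q] is a root of the characteristic polynomial modulo it,
    and both sides obey the same recurrence. *)
Lemma lucas_pow_congr b q n :
  (b * q - q * q - 1 |
   q ^ Z.of_nat n - (q * lucas b n - b * lucas b n + lucas b n.+1)).
Proof.
elim: n => [|n [k hk]]; first by exists 0; rewrite lucas0 lucas1 Z.pow_0_r; ring.
rewrite Nat2Z.inj_succ Z.pow_succ_r; last lia.
exists (q * k - lucas b n).
have -> : q ^ Z.of_nat n =
  k * (b * q - q * q - 1) + (q * lucas b n - b * lucas b n + lucas b n.+1) by lia.
by rewrite lucasSS; ring.
Qed.

End Lucas.

(** * Diophantine relations *)

Notation env := (nat -> nat).

Inductive poly :=
| PVar of nat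
| PConst of nat
| PAdd of poly & poly
| PMul of poly & poly.

Fixpoint peval (r : env) p :=
  match p with
  | PVar i => r i
  | PConst c => c
  | PAdd p q => peval r p + peval r q
  | PMul p q => peval r p * peval r q
  end.

Fixpoint psubst (f : nat -> poly) p :=
  match p with
  | PVar i => f i
  | PConst c => PConst c
  | PAdd p q => PAdd (psubst f p) (psubst f q)
  | PMul p q => PMul (psubst f p) (psubst f q)
  end.

Fixpoint pbound p :=
  match p with
  | PVar i => i.+1
  | PConst _ => 0
  | PAdd p q | PMul p q => maxn (pbound p) (pbound q)
  end.

Lemma peval_subst r f p : peval r (psubst f p) = peval (fun i => peval r (f i)) p.
Proof. by elim: p => //= p -> q ->. Qed.

Lemma peval_bound r r' p :
  (forall i, i < pbound p -> r i = r' i) -> peval r p = peval r' p.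
Proof.
elim: p => /= [i|c|p IHp q IHq|p IHp q IHq] h //; first exact: h.
- by rewrite IHp ?IHq // => i hi; apply: h; rewrite leq_max hi ?orbT.
- by rewrite IHp ?IHq // => i hi; apply: h; rewrite leq_max hi ?orbT.
Qed.

(** Parameters [r] sit at even and unknowns [s] at odd indices, so that neither supply has to be
    bounded in advance. *)
Definition interleave (r s : env) : env :=
  fun i => if odd i then s i./2 else r i./2.

Lemma interleave_even r s i : interleave r s i.*2 = r i.
Proof. by rewrite /interleave odd_double doubleK. Qed.

Lemma interleave_odd r s i : interleave r s i.*2.+1 = s i.
Proof. by rewrite /interleave /= odd_double /= uphalf_double. Qed.

Lemma interleave_evens r s : (fun i => interleave r s i.*2) = r.
Proof. by apply: functional_extensionality => i; rewrite interleave_even. Qed.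

Lemma interleave_odds r s : (fun i => interleave r s i.*2.+1) = s.
Proof. by apply: functional_extensionality => i; rewrite interleave_odd. Qed.

(** Two polynomials with natural coefficients replace one integer polynomial equated to zero. *)
Definition dio (R : env -> Prop) := exists p q, forall r,
  R r <-> exists s, peval (interleave r s) p = peval (interleave r s) q.

Lemma dio_ext R R' : (forall r, R r <-> R' r) -> dio R -> dio R'.
Proof. by move=> h [p [q e]]; exists p, q => r; rewrite -h. Qed.

Lemma dio_support R : dio R -> exists n, forall r r',
  (forall i, i < n -> r i = r' i) -> R r -> R r'.
Proof.
move=> [p [q e]]; exists (maxn (pbound p) (pbound q)) => r r' h /e[s hs].
apply/e; exists s; have hi i : i < maxn (pbound p) (pbound q) ->
    interleave r s i = interleave r' s i.
  by move=> hi; rewrite /interleave; case: ifP => // _; apply: h; lia.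
by rewrite -!(@peval_bound (interleave r s) (interleave r' s)) // => i ?;
   apply: hi; lia.
Qed.

Lemma dio_peq p q : dio (fun r => peval r p = peval r q).
Proof.
exists (psubst (fun i => PVar i.*2) p), (psubst (fun i => PVar i.*2) q) => r.
split=> [h|[s]]; first exists (fun=> 0).
  by rewrite !peval_subst /= interleave_evens.
by rewrite !peval_subst /= interleave_evens.
Qed.

Lemma dio_ren (f : nat -> nat) R : dio R -> dio (fun r => R (fun i => r (f i))).
Proof.
move=> [p [q e]].
pose g i := PVar (if odd i then i else (f i./2).*2).
exists (psubst g p), (psubst g q) => r; rewrite e.
suff h s : (fun i => peval (interleave r s) (g i)) =
    interleave (fun i => r (f i)) s.
  by split=> -[s hs]; exists s; rewrite !peval_subst h in hs *.
apply: functional_extensionality => i; rewrite /= /interleave.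
by case hi : (odd i); rewrite ?hi // odd_double doubleK.
Qed.

Lemma dio_exs R : dio R -> dio (fun r => exists s, R (interleave r s)).
Proof.
move=> [p [q e]].
(* Two blocks of unknowns [s] and [t] are merged into the single block [interleave s t]. *)
pose g i := PVar (if odd i then (i./2.*2.+1).*2.+1 else
                  if odd i./2 then (i./2./2.*2).*2.+1 else i./2./2.*2).
exists (psubst g p), (psubst g q) => r.
suff h s t : (fun i => peval (interleave r (interleave s t)) (g i)) =
    interleave (interleave r s) t.
  split=> [[s /e[t ht]]|[u]].
    by exists (interleave s t); rewrite !peval_subst h.
  have -> : u = interleave (fun i => u i.*2) (fun i => u i.*2.+1).
    apply: functional_extensionality => i; rewrite /interleave.
    by rewrite -[in LHS](odd_double_half i); case: odd; rewrite ?add0n ?add1n.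
  rewrite !peval_subst h => hu; exists (fun i => u i.*2); apply/e.
  by exists (fun i => u i.*2.+1).
apply: functional_extensionality => i /=.
rewrite [in RHS]/interleave; case: odd; first by rewrite !interleave_odd.
by case: odd; rewrite ?interleave_odd interleave_even.
Qed.

(** This is [(x - y)^2 + (z - t)^2 = 0] with the negative terms moved to the right. *)
Lemma sqr_sum_eq0 (x y z t : nat) :
  x * x + y * y + (z * z + t * t) = 2 * (x * y) + 2 * (z * t) <-> x = y /\ z = t.
Proof.
split=> [h|[-> ->]]; last lia.
have [h1 e1] := nat_Cauchy x y; have [h2 e2] := nat_Cauchy z t.
rewrite -!mulnn in h1 e1 h2 e2.
by split; apply/eqP; rewrite -?e1 -?e2; apply/eqP; lia.
Qed.

Lemma dio_and R S : dio R -> dio S -> dio (fun r => R r /\ S r).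
Proof.
move=> [p [q e]] [p' [q' e']].
(* The unknowns are renamed apart, even ones for [R] and odd ones for [S]; the parameters are
   shared. *)
pose f i := PVar (if odd i then i./2.*2.*2.+1 else i./2.*2).
pose g i := PVar (if odd i then i./2.*2.+1.*2.+1 else i./2.*2).
apply: (@dio_ext (fun r => exists s, let u := interleave r s in
  peval u (psubst f p) = peval u (psubst f q) /\
  peval u (psubst g p') = peval u (psubst g q'))).
  move=> r; rewrite e e' /=.
  have hf s t : (fun i => peval (interleave r (interleave s t)) (f i)) = interleave r s.
    apply: functional_extensionality => i /=; rewrite [in RHS]/interleave.
    by case: odd; rewrite ?interleave_odd interleave_even.
  have hg s t : (fun i => peval (interleave r (interleave s t)) (g i)) = interleave r t.
    apply: functional_extensionality => i /=; rewrite [in RHS]/interleave.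
    by case: odd; rewrite ?interleave_odd ?interleave_even.
  split=> [[u]|[[s hs] [t ht]]].
    have -> : u = interleave (fun i => u i.*2) (fun i => u i.*2.+1).
      apply: functional_extensionality => i; rewrite /interleave.
      by rewrite -[in LHS](odd_double_half i); case: odd; rewrite ?add0n ?add1n.
    by rewrite !peval_subst hf hg => -[h1 h2]; split; eexists; [exact: h1|exact: h2].
  by exists (interleave s t); rewrite !peval_subst hf hg.
pose sum p q p' q' :=
  PAdd (PAdd (PMul p p) (PMul q q)) (PAdd (PMul p' p') (PMul q' q')).
pose dot p q p' q' :=
  PAdd (PMul (PConst 2) (PMul p q)) (PMul (PConst 2) (PMul p' q')).
have [p1 [q1 h1]] := dio_exs (dio_peq
  (sum (psubst f p) (psubst f q) (psubst g p') (psubst g q'))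
  (dot (psubst f p) (psubst f q) (psubst g p') (psubst g q'))).
exists p1, q1 => r; rewrite -h1.
by split=> -[s hs]; exists s; apply/sqr_sum_eq0.
Qed.

Lemma dio_or R S : dio R -> dio S -> dio (fun r => R r \/ S r).
Proof.
move=> [p [q e]] [p' [q' e']].
(* This is [(p - q)(p' - q') = 0] without subtraction. Only one factor has to vanish, so the
   unknowns may be shared. *)
have [p1 [q1 h1]] := dio_exs (dio_peq
  (PAdd (PMul p p') (PMul q q')) (PAdd (PMul p q') (PMul q p'))).
exists p1, q1 => r; rewrite -h1 e e' /=; split.
  by case=> -[s hs]; exists s; rewrite hs; lia.
case=> s hs.
have [h|h] : peval (interleave r s) p = peval (interleave r s) q \/
             peval (interleave r s) p' = peval (interleave r s) q' by nia.
  by left; exists s.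
by right; exists s.
Qed.

Lemma dio_true : dio (fun _ => True).
Proof. by apply: dio_ext (dio_peq (PConst 0) (PConst 0)). Qed.

Lemma dio_all n (P : nat -> env -> Prop) : (forall i, dio (P i)) ->
  dio (fun r => forall i, i < n -> P i r).
Proof.
move=> h; elim: n => [|n IH]; first by apply: dio_ext dio_true.
apply: dio_ext (dio_and IH (h n)) => r; split=> [[h1 h2] i|h1].
  by rewrite ltnS leq_eqVlt => /orP[/eqP->|/h1].
by split=> [i hi|]; apply: h1; rewrite // ltnS ltnW.
Qed.

Definition behd (r : env) : env := fun i => r i.+1.

Definition scons x (r : env) : env := fun i => if i is j.+1 then r j else x.

(** Bound variables are de Bruijn indices: under the quantifier the new value is entry 0 and [behd]
    recovers the outer environment. *)
Lemma dio_ex (R : nat -> env -> Prop) : dio (fun r => R (r 0) (behd r)) ->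
  dio (fun r => exists x, R x r).
Proof.
move=> /(@dio_ren (fun i => if i is j.+1 then j.*2 else 1)) /dio_exs.
apply: dio_ext => r; rewrite /behd; split=> [[s]|[x]].
  by rewrite interleave_evens; exists (interleave r s 1).
by exists (fun=> x); rewrite interleave_evens.
Qed.

(** * Functions with a Diophantine graph *)

Definition dfun (f : env -> nat) := dio (fun r => r 0 = f (behd r)).

Lemma dfun_ext f g : (forall r, f r = g r) -> dfun f -> dfun g.
Proof. by move=> h; apply: dio_ext => r; rewrite h. Qed.

Lemma dfun_poly p : dfun (fun r => peval r p).
Proof.
apply: dio_ext (dio_peq (PVar 0) (psubst (fun i => PVar i.+1) p)) => r /=.
by rewrite peval_subst.
Qed.

Lemma dfun_var i : dfun (fun r => r i).
Proof. exact: (dfun_poly (PVar i)). Qed.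

Lemma dfun_const c : dfun (fun=> c).
Proof. exact: (dfun_poly (PConst c)). Qed.

Lemma dfun_behd f : dfun f -> dfun (fun r => f (behd r)).
Proof. exact: (@dio_ren (fun i => if i is j.+1 then j.+2 else 0)). Qed.

(** Each value [F i r] becomes an unknown. By [dio_support] only finitely many defining equations
    are imposed. *)
Lemma dio_subst R (F : nat -> env -> nat) : dio R -> (forall i, dfun (F i)) ->
  dio (fun r => R (fun i => F i r)).
Proof.
move=> hR hF; have [n hn] := dio_support hR.
have h1 i := @dio_ren (fun j => if j is k.+1 then k.*2 else i.*2.+1) _ (hF i).
have h2 := @dio_ren (fun i => i.*2.+1) _ hR.
apply: dio_ext (dio_exs (dio_and (@dio_all n _ h1) h2)) => r.
split=> [[s]|h].
  rewrite /behd interleave_evens interleave_odds => -[h3]; apply: hn => i hi.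
  by rewrite -h3 // interleave_odd.
exists (fun i => F i r); rewrite /behd interleave_evens interleave_odds.
by split=> // i _; rewrite interleave_odd.
Qed.

Lemma dfun_app1 h f : dio (fun r => r 0 = h (r 1)) -> dfun f ->
  dfun (fun r => h (f r)).
Proof.
move=> hh hf.
apply: (@dio_subst _ (fun i r => nth 0 [:: r 0; f (behd r)] i) hh).
case=> [|[|i]]; [exact: dfun_var|exact: dfun_behd|].
by rewrite /= nth_nil; exact: dfun_const.
Qed.

Lemma dio_app2 (R : nat -> nat -> Prop) f g : dio (fun r => R (r 0) (r 1)) ->
  dfun f -> dfun g -> dio (fun r => R (f r) (g r)).
Proof.
move=> hR hf hg; apply: (@dio_subst _ (fun i r => nth 0 [:: f r; g r] i) hR).
by case=> [|[|i]] //=; rewrite nth_nil; exact: dfun_const.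
Qed.

Lemma dio_app3 (R : nat -> nat -> nat -> Prop) f g h :
  dio (fun r => R (r 0) (r 1) (r 2)) ->
  dfun f -> dfun g -> dfun h -> dio (fun r => R (f r) (g r) (h r)).
Proof.
move=> hR hf hg hh.
apply: (@dio_subst _ (fun i r => nth 0 [:: f r; g r; h r] i) hR).
by case=> [|[|[|i]]] //=; rewrite nth_nil; exact: dfun_const.
Qed.

Lemma dfun_app2 h f g : dio (fun r => r 0 = h (r 1) (r 2)) ->
  dfun f -> dfun g -> dfun (fun r => h (f r) (g r)).
Proof.
move=> hh hf hg; apply: (@dio_app3 (fun x y z => x = h y z)) => //.
- exact: dfun_var.
- exact: dfun_behd.
- exact: dfun_behd.
Qed.

Lemma dfun_add f g : dfun f -> dfun g -> dfun (fun r => f r + g r).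
Proof. by apply: dfun_app2; exact: (dio_peq (PVar 0) (PAdd (PVar 1) (PVar 2))). Qed.

Lemma dfun_mul f g : dfun f -> dfun g -> dfun (fun r => f r * g r).
Proof. by apply: dfun_app2; exact: (dio_peq (PVar 0) (PMul (PVar 1) (PVar 2))). Qed.

Lemma dfun_succ f : dfun f -> dfun (fun r => (f r).+1).
Proof.
move=> hf; apply: dfun_ext (dfun_add hf (dfun_const 1)) => r; exact: addn1.
Qed.

Lemma dio_eq f g : dfun f -> dfun g -> dio (fun r => f r = g r).
Proof.
by apply: (@dio_app2 (fun x y => x = y)); exact: (dio_peq (PVar 0) (PVar 1)).
Qed.

(** A hook of [dio1], redefined as further closure properties become available. *)
Ltac dio_more := fail.

Ltac dio1 :=
  cbn beta;
  match goal with
  | |- dio (fun r => _ /\ _) => apply: dio_and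
  | |- dio (fun r => _ \/ _) => apply: dio_or
  | |- dio (fun r => exists _, _) => apply: dio_ex
  | |- _ => dio_more
  | |- dio (fun r => _ = _ :> nat) => apply: dio_eq
  | |- dfun (fun r => r _) => exact: dfun_var
  | |- dfun (fun r => behd _ _) => exact: dfun_var
  | |- dfun (fun r => _ + _) => apply: dfun_add
  | |- dfun (fun r => _ * _) => apply: dfun_mul
  | |- dfun (fun r => _.+1) => apply: dfun_succ
  | |- dfun (fun _ => _) => exact: dfun_const
  | _ => assumption
  end.
Ltac dioR := repeat dio1.

Lemma dio_le f g : dfun f -> dfun g -> dio (fun r => f r <= g r).
Proof.
apply: (@dio_app2 (fun x y => x <= y)).
apply: (@dio_ext (fun r => exists d, r 0 + d = r 1)); last by dioR.
by move=> r; split=> [[d <-]|h]; [exact: leq_addr|exists (r 1 - r 0); rewrite subnKC].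
Qed.

Lemma dio_dvdn f g : dfun f -> dfun g -> dio (fun r => f r %| g r).
Proof.
apply: (@dio_app2 (fun x y => x %| y)).
apply: (@dio_ext (fun r => exists k, r 1 = k * r 0)); last by dioR.
by move=> r; split=> /dvdnP.
Qed.

Lemma eqmodP x y m : (x = y %[mod m]) <-> exists k l, x + k * m = y + l * m.
Proof.
split=> [h|[k [l h]]]; last by rewrite -(modnMDl k x) addnC h addnC modnMDl.
exists (y %/ m), (x %/ m); rewrite {1}(divn_eq x m) {2}(divn_eq y m) h; lia.
Qed.

Lemma dio_eqmod f g h : dfun f -> dfun g -> dfun h ->
  dio (fun r => f r = g r %[mod h r]).
Proof.
apply: (@dio_app3 (fun x y z => x = y %[mod z])).
apply: (@dio_ext (fun r => exists k l, r 0 + k * r 2 = r 1 + l * r 2)); last by dioR.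
by move=> r; rewrite eqmodP.
Qed.

Ltac dio_more ::=
  match goal with
  | |- dio (fun r => is_true (_ <= _)) => apply: dio_le
  | |- dio (fun r => is_true (_ %| _)) => apply: dio_dvdn
  | |- dio (fun r => _ = _ %[mod _]) => apply: dio_eqmod
  end.

(** * Exponentiation, factorials and products *)

Lemma eqmodZP x y m :
  (x = y %[mod m]) <-> (Z.of_nat m | Z.of_nat x - Z.of_nat y)%Z.
Proof.
rewrite eqmodP; split=> [[k [l h]]|[z hz]].
  by exists (Z.of_nat l - Z.of_nat k)%Z; lia.
by exists (Z.to_nat (- z)), (Z.to_nat z); nia.
Qed.

Definition lucas_rel (b a n : nat) :=
  3 < b /\ Z.of_nat a = lucas (Z.of_nat b) n.

(** The system of [lucas_sound] and [lucas_complete] over the naturals; [k] is the cofactor of [u^2]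
    in [s]. *)
Lemma lucas_relP b a c : lucas_rel b a c <->
  exists u t s r v w x y k,
    3 < b /\ u * u + t * t = b * u * t + 1 /\ s * s + r * r = b * s * r + 1 /\
    r < s /\ s = k * (u * u) /\ v + 2 * r = b * s /\
    (w = b %[mod v]) /\ (w = 2 %[mod u]) /\ 2 < w /\
    x * x + y * y = w * x * y + 1 /\ 2 * a < u /\ 2 * a < v /\
    (a = x %[mod v]) /\ 2 * c < u /\ (c = x %[mod u]).
Proof.
split=> [[hb ha]|].
  have [|u [t [s [r [v [w [x [y H]]]]]]]] := @lucas_complete (Z.of_nat b) c.
    lia.
  case: H => -[u0 t0 r0 w0 x0] [y0 [[hu hs [k us]] [[hv vw uw hx] [au av vax cu ucx]]]].
  have k0 : (0 <= k)%Z by nia.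
  have nat_of (z : Z) : (0 <= z)%Z -> exists n, z = Z.of_nat n.
    by move=> hz; exists (Z.to_nat z); rewrite Z2Nat.id.
  have [|v' ev] := nat_of v; first lia.
  have [|w' ew] := nat_of w; first lia.
  have [|s' es] := nat_of s; first lia.
  have [|r' er] := nat_of r; first lia.
  have [[u' eu] [t' et]] := (nat_of u u0, nat_of t t0).
  have [[x' ex] [y' ey]] := (nat_of x x0, nat_of y y0).
  have [k' ek] := nat_of k k0.
  have {}hv : (v + 2 * r = Z.of_nat b * s)%Z by lia.
  have {}us : (s - k * (u * u) = 0)%Z by lia.
  subst; exists u', t', s', r', v', w', x', y', k'.
  rewrite -ha in au av vax; do ![split]; try apply/eqmodZP; try assumption; lia.
case=> u [t [s [r [v [w [x [y [k H]]]]]]]].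
case: H => hb [hu [hs [rs [us [hv [vw [uw [w2 [hx [au [av [vax [cu ucx]]]]]]]]]]]]].
split=> //; rewrite -(Nat2Z.id c).
move/eqmodZP: vw => vw; move/eqmodZP: uw => uw; move/eqmodZP: vax => vax.
move/eqmodZP: ucx => ucx.
apply: (@lucas_sound (Z.of_nat b) (Z.of_nat a) (Z.of_nat c) (Z.of_nat u)
  (Z.of_nat t) (Z.of_nat s) (Z.of_nat r) (Z.of_nat v) (Z.of_nat w)
  (Z.of_nat x) (Z.of_nat y)) => //; try lia.
by exists (Z.of_nat k); lia.
Qed.

Lemma dio_lucas : dio (fun r => lucas_rel (r 0) (r 1) (r 2)).
Proof.
by apply: (dio_ext (fun r => iff_sym (lucas_relP (r 0) (r 1) (r 2)))); dioR.
Qed.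

(** By [lucas_pow_congr] the power is known modulo [m]. The term [g] bounds the power from above and
    enters [b], which makes [m] exceed the power, so the residue determines it. *)
Lemma expS_P q n p : p = q.+1 ^ n <->
  exists g b m x y, lucas_rel (q + 5) g n.+1 /\ b = g + q.+1 * q.+1 + 2 /\
    lucas_rel b x n /\ lucas_rel b y n.+1 /\ m + q.+1 * q.+1 + 1 = b * q.+1 /\
    p < m /\ (p + b * x = q.+1 * x + y %[mod m]).
Proof.
set Q := q.+1.
have key g b m x y : lucas_rel (q + 5) g n.+1 -> b = g + Q * Q + 2 ->
    lucas_rel b x n -> lucas_rel b y n.+1 -> m + Q * Q + 1 = b * Q ->
    Q ^ n < m /\ (Q ^ n + b * x = Q * x + y %[mod m]).
  move=> [_ hg] hb [_ hx] [_ hy] hm.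
  have hgp : Q ^ n <= g.
    have := @lucas_ge_pow (Z.of_nat (q + 5)) n; rewrite -hg => /(_ ltac:(lia)).
    have : (Z.of_nat Q ^ Z.of_nat n <= (Z.of_nat (q + 5) - 1) ^ Z.of_nat n)%Z.
      by apply: Z.pow_le_mono_l; lia.
    by lia.
  split; first by rewrite /Q in hm hb hgp *; nia.
  have [k hk] := lucas_pow_congr (Z.of_nat b) (Z.of_nat Q) n.
  apply/eqmodZP; rewrite -hx -hy in hk; exists k.
  have -> : (Z.of_nat m = Z.of_nat b * Z.of_nat Q - Z.of_nat Q * Z.of_nat Q - 1)%Z.
    by lia.
  by rewrite -hk; lia.
split=> [->|].
  have lucasN b c : 3 < b -> lucas_rel b (Z.to_nat (lucas (Z.of_nat b) c)) c.
    move=> hb; split=> //; rewrite Z2Nat.id //.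
    by apply: lucas_ge0; lia.
  set g := Z.to_nat (lucas (Z.of_nat (q + 5)) n.+1).
  have hg : lucas_rel (q + 5) g n.+1 by apply: lucasN; lia.
  pose b := g + Q * Q + 2.
  have g1 : 0 < g.
    by have := @lucas_ge_id (Z.of_nat (q + 5)) n.+1; case: hg => _ <-; lia.
  have hb : 3 < b by rewrite /b /Q; lia.
  pose x := Z.to_nat (lucas (Z.of_nat b) n).
  pose y := Z.to_nat (lucas (Z.of_nat b) n.+1).
  have hx : lucas_rel b x n by exact: lucasN.
  have hy : lucas_rel b y n.+1 by exact: lucasN.
  have hm : (b * Q - Q * Q - 1) + Q * Q + 1 = b * Q by rewrite /b /Q; nia.
  exists g, b, (b * Q - Q * Q - 1), x, y.
  by have [h1 h2] := key g b _ x y hg erefl hx hy hm; do 6!split=> //.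
case=> g [b [m [x [y [hg [hb [hx [hy [hm [pm hp]]]]]]]]]].
have [h1 h2] := key g b m x y hg hb hx hy hm.
rewrite -(modn_small pm) -(modn_small h1); apply/eqP.
by rewrite -(eqn_modDr (b * x)) hp -h2.
Qed.

Lemma dfun_expS f g : dfun f -> dfun g -> dfun (fun r => (f r).+1 ^ g r).
Proof.
apply: (@dfun_app2 (fun x y => x.+1 ^ y)).
apply: (dio_ext (fun r => iff_sym (expS_P (r 1) (r 2) (r 0)))).
by dioR; apply: (@dio_app3 lucas_rel _ _ _ dio_lucas); dioR.
Qed.

Lemma dfun_expn f g : dfun f -> dfun g -> dfun (fun r => f r ^ g r).
Proof.
apply: dfun_app2.
(* Base 0 is treated apart, with [0 ^ 0 = 1]. *)
apply: (@dio_ext (fun r => (r 1 = 0 /\ r 2 = 0 /\ r 0 = 1) \/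
   ((exists n, r 1 = 0 /\ r 2 = n.+1 /\ r 0 = 0) \/
   (exists q, r 1 = q.+1 /\ r 0 = q.+1 ^ r 2)))); last first.
  by dioR; apply: dio_eq; dioR; apply: dfun_expS; dioR.
move=> r; split=> [[[-> [-> ->]]|[[n [-> [-> ->]]]|[q [-> ->]]]]|->] //.
  by rewrite exp0n.
case: (r 1) => [|q]; last by right; right; exists q.
case: (r 2) => [|n]; first by left.
by right; left; exists n; rewrite exp0n.
Qed.

Lemma dfun_divn f g : dfun f -> dfun g -> dfun (fun r => f r %/ g r).
Proof.
(* The first disjunct is the convention that division by zero yields 0. *)
apply: dfun_app2; apply: (@dio_ext (fun r => (r 2 = 0 /\ r 0 = 0) \/
  exists d, r 1 = r 0 * r 2 + d /\ d < r 2)); last by dioR.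
move=> r; split=> [[[-> ->]|[d [-> hd]]]|->]; first by rewrite divn0.
  by rewrite divnMDl ?divn_small ?addn0 // (leq_trans _ hd).
have [->|h] := posnP (r 2); first by left; rewrite divn0.
by right; exists (r 1 %% r 2); rewrite ltn_mod -divn_eq.
Qed.

Ltac dio_more ::=
  match goal with
  | |- dio (fun r => is_true (_ <= _)) => apply: dio_le
  | |- dio (fun r => is_true (_ %| _)) => apply: dio_dvdn
  | |- dio (fun r => _ = _ %[mod _]) => apply: dio_eqmod
  | |- dfun (fun r => _ ^ _) => apply: dfun_expn
  | |- dfun (fun r => _ %/ _) => apply: dfun_divn
  end.

Lemma dfun_modn f g : dfun f -> dfun g -> dfun (fun r => f r %% g r).
Proof.
apply: dfun_app2.
apply: (@dio_ext (fun r => r 1 = r 1 %/ r 2 * r 2 + r 0)).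
  move=> r; rewrite [X in X = _](divn_eq (r 1) (r 2)).
  by split=> [/addnI->|->].
by dioR.
Qed.

(** * Binomial coefficients and factorials *)

Lemma bin_le_exp2 n k : 'C(n, k) <= 2 ^ n.
Proof.
elim: n k => [|n IH] [|k] //; first by rewrite bin0 expn_gt0.
by rewrite binS expnS mul2n -addnn leq_add.
Qed.

Lemma digit_sum u m (a : nat -> nat) k : (forall i, a i < u) ->
  (\sum_(i < m) a i * u ^ i) %/ u ^ k %% u = if k < m then a k else 0.
Proof.
move=> hu; have u0 : 0 < u by apply: leq_trans (hu 0).
elim: m a k hu => [|m IH] a k hu; first by rewrite big_ord0 div0n mod0n.
have -> : \sum_(i < m.+1) a i * u ^ i = (\sum_(i < m) a i.+1 * u ^ i) * u + a 0.
  rewrite big_ord_recl muln1 addnC big_distrl /=; congr (_ + _).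
  by apply: eq_bigr => i _; rewrite expnS -mulnA (mulnC u).
case: k => [|k]; first by rewrite divn1 modnMDl modn_small.
by rewrite expnS divnMA divnMDl // (divn_small (hu 0)) addn0 ltnS (IH (fun i => a i.+1)).
Qed.

(** In base [u = 2^n + 1] the digits of [(u + 1)^n] are the binomial coefficients, each being at
    most [2^n]. *)
Lemma bin_digit n k :
  'C(n, k) = (2 ^ n).+2 ^ n %/ (2 ^ n).+1 ^ k %% (2 ^ n).+1.
Proof.
set u := (2 ^ n).+1.
have -> : u.+1 ^ n = \sum_(i < n.+1) 'C(n, i) * u ^ i.
  by rewrite -add1n expnDn; apply: eq_bigr => i _; rewrite exp1n mul1n.
rewrite (@digit_sum u n.+1 (fun i => 'C(n, i))) => [|i]; last first.
  by rewrite ltnS bin_le_exp2.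
by case: ltnP => // h; rewrite bin_small.
Qed.

Lemma dfun_bin f g : dfun f -> dfun g -> dfun (fun r => 'C(f r, g r)).
Proof.
move=> hf hg; apply: (dfun_ext (fun r => esym (bin_digit (f r) (g r)))).
by apply: dfun_modn; dioR.
Qed.

Lemma fact_le_expn n : n`! <= n.+2 ^ n.
Proof.
elim: n => // n IH; rewrite factS expnS leq_mul //; first by lia.
apply: leq_trans IH _; case: n => // n; by rewrite leq_exp2r.
Qed.

Lemma ffact_le_expn r n : r ^_ n <= r ^ n.
Proof.
elim: n => // n IH; rewrite ffactnSr expnSr leq_mul //; exact: leq_subr.
Qed.

Lemma expn_le_ffact r n : r * r ^ n <= r * r ^_ n + n * n * r ^ n.
Proof.
elim: n => [|n IH]; first by rewrite leq_addr.
have h := ffact_le_expn r n; rewrite ffactnSr expnS.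
have h1 : r * r * r ^ n <= r * r * r ^_ n + r * (n * n * r ^ n) by nia.
have h2 : r * r ^_ n * r <= r * r ^_ n * (r - n) + r * r ^_ n * n.
  by rewrite -mulnDr; apply: leq_mul => //; lia.
have h3 : r * r ^_ n * n <= r * r ^ n * n by rewrite !leq_mul.
have e : r * r ^_ n * r = r * r * r ^_ n by lia.
have e1 : r * (r ^_ n * (r - n)) = r * r ^_ n * (r - n) by lia.
rewrite e1; nia.
Qed.

(* [n! = r^n / C(r, n)], rounded down, once [r] is large compared to [n]. *)
Lemma fact_div n : let r := n.+2 ^ n.+3 in n`! = r ^ n %/ 'C(r, n).
Proof.
move=> r; have hr : (n`!).+1 * (n * n) < r.
  have h1 := fact_le_expn n.
  have h2 : 0 < n.+2 ^ n by rewrite expn_gt0.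
  rewrite /r !expnS; set z := n.+2 ^ n in h1 h2 *.
  have h3 : (n`!).+1 <= 2 * z by lia.
  apply: (@leq_ltn_trans (2 * z * (n * n))); first by rewrite leq_mul.
  by nia.
have hf : r ^_ n <= r ^ n := ffact_le_expn r n.
have hL := expn_le_ffact r n.
have hb := bin_ffact r n; set B := 'C(r, n) in hb *.
have r0 : 0 < r by rewrite expn_gt0.
have rn0 : 0 < r ^ n by rewrite expn_gt0 r0.
have f0 := fact_gt0 n.
(* In [r^n = n! B + (r^n - r ^_ n)] the second summand is thus a true remainder modulo [B]. *)
have key : r ^ n - r ^_ n < B.
  have h1 : r * (r ^ n - r ^_ n) <= n * n * r ^ n by nia.
  have h2 : n`! * (r * (r ^ n - r ^_ n)) < r * r ^_ n.
    apply: (@leq_ltn_trans (n`! * (n * n * r ^ n))); first by rewrite leq_mul.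
    have h3 : (n`!).+1 * (n * n) * r ^ n < r * r ^ n by rewrite ltn_mul2r rn0.
    by move: h3 hL; set W := r ^ n; lia.
  have : (n`! * r) * (r ^ n - r ^_ n) < (n`! * r) * B.
    by rewrite -mulnA (leq_trans h2) // -hb; lia.
  by rewrite ltn_mul2l => /andP[].
rewrite -(subnK hf) -hb addnC mulnC divnMDl; last by lia.
by rewrite divn_small ?addn0 // mulnC hb.
Qed.

Lemma dfun_fact f : dfun f -> dfun (fun r => (f r)`!).
Proof.
move=> hf; apply: (dfun_ext (fun r => esym (fact_div (f r)))).
by apply: dfun_divn; last apply: dfun_bin; dioR.
Qed.

Lemma dfun_ffact f g : dfun f -> dfun g -> dfun (fun r => f r ^_ g r).
Proof.
move=> hf hg; apply: (dfun_ext (fun r => bin_ffact (f r) (g r))).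
by apply: dfun_mul; [exact: dfun_bin|exact: dfun_fact].
Qed.

Ltac dio_more ::=
  match goal with
  | |- dio (fun r => is_true (_ <= _)) => apply: dio_le
  | |- dio (fun r => is_true (_ %| _)) => apply: dio_dvdn
  | |- dio (fun r => _ = _ %[mod _]) => apply: dio_eqmod
  | |- dfun (fun r => _ ^ _) => apply: dfun_expn
  | |- dfun (fun r => _ %/ _) => apply: dfun_divn
  | |- dfun (fun r => _ %% _) => apply: dfun_modn
  | |- dfun (fun r => 'C(_, _)) => apply: dfun_bin
  | |- dfun (fun r => _`!) => apply: dfun_fact
  | |- dfun (fun r => _ ^_ _) => apply: dfun_ffact
  end.

(** * Products of the moduli of Goedel's beta function *)

Definition beta_mod (t i : nat) := (i.+1 * t).+1.

Lemma prod_beta_mod_le t y :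
  \prod_(i < y) beta_mod t i <= (y * t).+1 ^ y.
Proof.
rewrite -[X in _ ^ X](card_ord y) -prod_nat_const; apply: leq_prod => i _.
by rewrite /beta_mod ltnS leq_mul.
Qed.

(* Modulo [K = t W + 1] the number [K - W] is the inverse of [t], which turns
   the product of the [1 + (i + 1) t] into a falling factorial. *)
Lemma prod_beta_mod_ffact t y : let W := (y * t.+1).+1 ^ y in
  let K := (t.+1 * W).+1 in
  \prod_(i < y) beta_mod t.+1 i = (t.+1 ^ y * ((t * W).+1 + y) ^_ y) %% K.
Proof.
move=> W K; set q := (t * W).+1.
have tq : t.+1 * q = t * K + 1 by rewrite /q /K; lia.
have h n : \prod_(i < n) beta_mod t.+1 i = t.+1 ^ n * (q + n) ^_ n %[mod K].
  elim: n => [|n IH]; first by rewrite big_ord0.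
  rewrite big_ord_recr /= -modnMml IH modnMml expnS addnS ffactSS.
  have -> : t.+1 * t.+1 ^ n * ((q + n).+1 * (q + n) ^_ n) =
    t.+1 ^ n * (q + n) ^_ n * (t.+1 * (q + n).+1) by lia.
  rewrite -[LHS]modnMmr -[RHS]modnMmr; congr (_ * _ %% _).
  have -> : t.+1 * (q + n).+1 = t * K + beta_mod t.+1 n.
    by rewrite /beta_mod; lia.
  by rewrite modnMDl.
(* The product is at most [W], hence below [K], and equals its own residue. *)
rewrite -h modn_small // /K ltnS (leq_trans (prod_beta_mod_le _ _)) //.
exact: leq_pmull.
Qed.

Lemma dfun_prod_beta_mod f g : dfun f -> dfun g ->
  dfun (fun r => \prod_(i < g r) beta_mod (f r).+1 i).
Proof.
move=> hf hg.
apply: (dfun_ext (fun r => esym (prod_beta_mod_ffact (f r) (g r)))).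
by dioR.
Qed.

(** * Bounded quantification *)

Fixpoint crt (m f : nat -> nat) n :=
  if n is k.+1 then chinese (\prod_(i < k) m i) (m k) (crt m f k) (f k) else 0.

Definition pairwise_coprime (m : nat -> nat) n :=
  forall i j, i < j -> j < n -> coprime (m i) (m j).

Lemma coprime_prodl (m : nat -> nat) n : pairwise_coprime m n.+1 ->
  coprime (\prod_(i < n) m i) (m n).
Proof.
move=> h; elim/big_ind: _ => [|x y hx hy|i _]; first exact: coprime1n.
  by rewrite coprimeMl hx.
exact: h.
Qed.

Lemma pairwise_coprimeW m n : pairwise_coprime m n.+1 -> pairwise_coprime m n.
Proof. by move=> h i j ij jn; apply: h => //; apply: ltnW. Qed.

Lemma eqmod_dvd d m x y : d %| m -> x = y %[mod m] -> x = y %[mod d].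
Proof. by move=> dm h; rewrite -(modn_dvdm x dm) h modn_dvdm. Qed.

Lemma crtP m f n i : pairwise_coprime m n -> i < n -> crt m f n = f i %[mod m i].
Proof.
elim: n => // n IH hm; rewrite ltnS leq_eqVlt /= => /orP[/eqP->|hi].
  by rewrite chinese_modr // coprime_prodl.
rewrite -(IH (pairwise_coprimeW hm) hi).
apply: (@eqmod_dvd _ (\prod_(i < n) m i)).
  by rewrite (bigD1 (Ordinal hi)) //= dvdn_mulr.
by rewrite chinese_modl // coprime_prodl.
Qed.

Lemma eqmod_prod m n x y : pairwise_coprime m n ->
  (forall i, i < n -> x = y %[mod m i]) -> x = y %[mod \prod_(i < n) m i].
Proof.
elim: n => [|n IH] hm h; first by rewrite big_ord0 !modn1.
rewrite big_ord_recr /=; apply/eqP; rewrite chinese_remainder ?coprime_prodl //.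
rewrite h // eqxx andbT IH //; first exact: pairwise_coprimeW.
by move=> i hi; apply: h; apply: ltnW.
Qed.

Lemma prime_beta_mod_gt N t i p : prime p -> N`! %| t -> p %| beta_mod t i -> N < p.
Proof.
move=> pp hN hp; rewrite ltnNge; apply/negP => hpN.
have pt : p %| t by apply: dvdn_trans hN; apply: dvdn_fact; rewrite prime_gt0.
move: hp; rewrite /beta_mod -addn1 dvdn_addr ?dvdn_mull // dvdn1.
by move/eqP => p1; rewrite p1 in pp.
Qed.

(** A common prime divides [(j - i) t]. It cannot divide [t], and it exceeds [N], hence cannot
    divide [j - i]. *)
Lemma beta_mod_coprime N t n : N`! %| t -> n <= N.+1 ->
  pairwise_coprime (beta_mod t) n.
Proof.
move=> hN nN i j ij jn; apply: contraT => hc.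
have gt1 : 1 < gcdn (beta_mod t i) (beta_mod t j).
  by rewrite ltn_neqAle eq_sym hc gcdn_gt0.
have pp := pdiv_prime gt1; set p := pdiv _ in pp.
have pi : p %| beta_mod t i by apply: dvdn_trans (dvdn_gcdl _ _); exact: pdiv_dvd.
have pj : p %| beta_mod t j by apply: dvdn_trans (dvdn_gcdr _ _); exact: pdiv_dvd.
have Np := prime_beta_mod_gt pp hN pi.
have : p %| beta_mod t j - beta_mod t i by rewrite dvdn_sub.
have -> : beta_mod t j - beta_mod t i = (j - i) * t.
  by rewrite /beta_mod subSS -mulnBl subSS.
rewrite Euclid_dvdM // => /orP[h|pt].
  have ji : 0 < j - i by rewrite subn_gt0.
  have := leq_ltn_trans (leq_trans (dvdn_leq ji h) (leq_subr i j)) jn.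
  by rewrite ltnNge (leq_trans nN Np).
move: pi; rewrite /beta_mod -addn1 dvdn_addr ?dvdn_mull // dvdn1.
by move/eqP => p1; rewrite p1 in pp.
Qed.

Lemma dvdn_ffact_factor v k a : v < k -> a - v %| a ^_ k.
Proof.
elim: k => // k IH; rewrite ltnS leq_eqVlt ffactnSr => /orP[/eqP->|/IH h].
  exact: dvdn_mull.
exact: dvdn_mulr.
Qed.

(** A divisibility expresses that [a] has a residue below [k]; [prime_dvd_ffact] is the converse for
    prime moduli. If [a < v], the truncated factor [a - v] is 0. *)
Lemma eqmod_dvd_ffact m a v k : a = v %[mod m] -> v < k -> m %| a ^_ k.
Proof.
move=> h vk; apply: dvdn_trans (dvdn_ffact_factor a vk).
have [va|av] := leqP v a; first by rewrite -eqn_mod_dvd //; apply/eqP.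
by rewrite (eqP (ltnW av)).
Qed.

Lemma prime_dvd_ffact p a k : prime p -> p %| a ^_ k -> a %% p < k.
Proof.
move=> pp; elim: k => [|k IH].
  by rewrite ffactn0 dvdn1 => /eqP p1; rewrite p1 in pp.
rewrite ffactnSr Euclid_dvdM // => /orP[/IH|h]; first exact: ltnW.
rewrite ltnS; have [ak|ka] := leqP a k; first exact: leq_trans (leq_mod _ _) ak.
by move: h; rewrite -eqn_mod_dvd ?(ltnW ka) // => /eqP->; exact: leq_mod.
Qed.

Lemma eqmod_mull_cancel p T x y : coprime T p -> T * x = T * y %[mod p] -> x = y %[mod p].
Proof.
wlog xy : x y / x <= y => [H|] hc h.
  by have [xy|/ltnW xy] := leqP x y; [apply: H|apply/esym; apply: H].
apply/esym/eqP; rewrite eqn_mod_dvd // -(Gauss_dvdr _ (n := T)) 1?coprime_sym //.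
by rewrite mulnBr -eqn_mod_dvd ?leq_mul //; apply/eqP/esym.
Qed.

Lemma beta_mod_eqmod t m x y :
  x = y %[mod m] -> beta_mod t x = beta_mod t y %[mod m].
Proof.
move=> /eqmodP[k [l h]]; apply/eqmodP; exists (k * t), (l * t).
have e : (x + k * m) * t = (y + l * m) * t by rewrite h.
by rewrite /beta_mod; lia.
Qed.

Lemma beta_mod_inj_eqmod N t p i j : prime p -> N`! %| t ->
  p %| beta_mod t i -> p %| beta_mod t j -> i = j %[mod p].
Proof.
move=> pp hN pi pj.
have tp : coprime t p.
  rewrite coprime_sym prime_coprime //; apply/negP => pt.
  move: pi; rewrite /beta_mod -addn1 dvdn_addr ?dvdn_mull // dvdn1.
  by move/eqP => p1; rewrite p1 in pp.
apply: (eqmod_mull_cancel tp).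
have h : beta_mod t i = beta_mod t j %[mod p] by rewrite (eqP pi) (eqP pj).
have eb k : beta_mod t k = t * k + t.+1 by rewrite /beta_mod; lia.
by apply/eqP; rewrite -(eqn_modDr t.+1) -!eb; apply/eqP.
Qed.

Lemma peval_mono r r' p :
  (forall i, i < pbound p -> r i <= r' i) -> peval r p <= peval r' p.
Proof.
elim: p => /= [i|c|p IHp q IHq|p IHp q IHq] h //; first exact: h.
- by apply: leq_add; [apply: IHp|apply: IHq] => i hi; apply: h; lia.
- by apply: leq_mul; [apply: IHp|apply: IHq] => i hi; apply: h; lia.
Qed.

Lemma peval_eqmod m r r' p :
  (forall i, i < pbound p -> r i = r' i %[mod m]) ->
  peval r p = peval r' p %[mod m].
Proof.
elim: p => /= [i|c|p IHp q IHq|p IHp q IHq] h //; first exact: h.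
- by rewrite -modnDm IHp ?IHq ?modnDm // => i hi; apply: h; rewrite leq_max hi ?orbT.
- by rewrite -modnMm IHp ?IHq ?modnMm // => i hi; apply: h; rewrite leq_max hi ?orbT.
Qed.

Lemma finite_choice T (x0 : T) n (P : nat -> T -> Prop) :
  (forall z, z < n -> exists s, P z s) ->
  exists S : nat -> T, forall z, z < n -> P z (S z).
Proof.
elim: n => [|n IH] h; first by exists (fun=> x0).
have [S hS] := IH (fun z hz => h z (ltnW hz)); have [s hs] := h n (ltnSn n).
exists (fun z => if z == n then s else S z) => z.
by rewrite ltnS leq_eqVlt; case: eqP => [->|_] //= /hS.
Qed.

(** Polynomials with natural coefficients are monotone, so this bounds both sides of the equation
    for all [z <= y] and all witnesses up to [u]. *)
Definition ball_bound r y u p q :=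
  y + u + (peval (interleave (scons y r) (fun=> u)) p +
           peval (interleave (scons y r) (fun=> u)) q).

Lemma peval_le_ball_bound r y u p q (e := interleave (scons y r) (fun=> u)) :
  peval e p <= ball_bound r y u p q /\ peval e q <= ball_bound r y u p q.
Proof.
by rewrite /ball_bound -/e; split; [rewrite addnCA leq_addr|rewrite addnA leq_addl].
Qed.

Lemma half_le i : i./2 <= i. Proof. by lia. Qed.

(* [s 0] bounds the witnesses for all [z < y], [s 2] is the product of the
   moduli, and [s 3], [s (i + 4)] code [z] and the [i]-th witness by the Chinese
   remainder theorem; the falling factorial bounds the decoded witnesses. *)
Definition ball_system r y p q (s : env) :=
  (s 1).+1 = (ball_bound r y (s 0) p q)`! /\
  s 2 = \prod_(i < y) beta_mod (s 1).+1 i /\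
  s 2 %| beta_mod (s 1).+1 (s 3) /\
  (forall i, i < maxn (pbound p) (pbound q) -> s 2 %| s (i + 4) ^_ (s 0).+1) /\
  (peval (interleave (scons (s 3) r) (fun i => s (i + 4))) p =
   peval (interleave (scons (s 3) r) (fun i => s (i + 4))) q %[mod s 2]).

Lemma ball_system_complete r y p q :
  (forall z, z < y -> exists s,
     peval (interleave (scons z r) s) p = peval (interleave (scons z r) s) q) ->
  exists s, ball_system r y p q s.
Proof.
move=> /(finite_choice (fun=> 0))[S hS]; set n := maxn (pbound p) (pbound q).
pose u := \max_(z < y) \max_(i < n) S z i.
have hu z i : z < y -> i < n -> S z i <= u.
  move=> zy im; apply: leq_trans (leq_bigmax (Ordinal zy)).
  exact: (leq_bigmax (F := fun i : 'I_n => S z i) (Ordinal im)).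
set N := ball_bound r y u p q; pose t := (N`!).-1.
have tN : t.+1 = N`! by rewrite prednK // fact_gt0.
have hcop : pairwise_coprime (beta_mod t.+1) y.
  by apply: (@beta_mod_coprime N); rewrite ?tN // /N /ball_bound; lia.
pose m := beta_mod t.+1; pose M := \prod_(i < y) m i.
(* Modulo the [z]-th modulus, [c] is [z] and [a i] is the [i]-th witness for [z]. *)
pose c := crt m id y; pose a i := crt m (fun z => S z i) y.
exists (fun i => if i is j.+4 then a j else nth 0 [:: u; t; M; c] i).
have e : (fun i => if i + 4 is j.+4 then a j else nth 0 [:: u; t; M; c] (i + 4)) = a.
  by apply: functional_extensionality => i; rewrite addnC.
rewrite /ball_system e /= -/N -/n; split=> //; split=> //.
have dvdM x : (forall z, z < y -> m z %| x) -> M %| x.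
  move=> h; rewrite /dvdn -[0](mod0n M); apply/eqP; apply: eqmod_prod => // z zy.
  by rewrite mod0n; apply/eqP/h.
split; [|split].
- apply: dvdM => z zy; have hc : c = z %[mod m z] by exact: crtP.
  by rewrite /dvdn (beta_mod_eqmod _ hc) modnn.
- move=> i hi; apply: dvdM => z zy; rewrite addnC /=.
  by apply: (@eqmod_dvd_ffact _ _ (S z i)); [exact: crtP|rewrite ltnS hu].
- apply: eqmod_prod => // z zy.
  have hvar i : i < n -> interleave (scons c r) a i =
      interleave (scons z r) (S z) i %[mod m z].
    move=> hi; rewrite /interleave; case: odd; first exact: crtP.
    by case: i./2 => //=; exact: crtP.
  rewrite (@peval_eqmod _ _ (interleave (scons z r) (S z))) => [|i hi]; last first.
    by apply: hvar; rewrite /n; lia.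
  rewrite hS //; apply/esym; apply: peval_eqmod => i hi.
  by apply: hvar; rewrite /n; lia.
Qed.

(** A prime [d] dividing the [z]-th modulus exceeds [N]. Modulo [d], [c] is [z], and the residues of
    the [a i] that occur are at most [u]. Both sides of the equation at these residues are congruent
    and below [d], hence equal. *)
Lemma ball_system_sound r y p q s : ball_system r y p q s ->
  forall z, z < y -> exists s',
    peval (interleave (scons z r) s') p = peval (interleave (scons z r) s') q.
Proof.
rewrite /ball_system; set u := s 0; set t := (s 1).+1; set M := s 2; set c := s 3.
set a := fun i => s (i + 4); set N := ball_bound _ _ _ _ _.
move=> [tN [hM [Mc [Ma hpq]]]] z zy.
have m1 : 1 < beta_mod t z by rewrite /beta_mod /t.
have pp := pdiv_prime m1; set d := pdiv _ in pp.
have dz : d %| beta_mod t z by exact: pdiv_dvd.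
have dM : d %| M.
  by apply: dvdn_trans dz _; rewrite hM (bigD1 (Ordinal zy)) //= dvdn_mulr.
have Nt : N`! %| t by rewrite tN.
have Nd : N < d by exact: (prime_beta_mod_gt pp Nt dz).
have cz : c = z %[mod d].
  by apply: (beta_mod_inj_eqmod pp Nt) => //; exact: dvdn_trans Mc.
pose s' i := a i %% d; exists s'.
have su i : i < maxn (pbound p) (pbound q) -> s' i <= u.
  by move=> hi; rewrite -ltnS; apply: prime_dvd_ffact => //; exact: dvdn_trans (Ma i hi).
have hmod e : peval (interleave (scons c r) a) e =
    peval (interleave (scons z r) s') e %[mod d].
  apply: peval_eqmod => i hi; rewrite /interleave; case: odd.
    by rewrite /s' modn_mod.
  by case: i./2.
have hle e : (forall i, i < pbound e -> i < maxn (pbound p) (pbound q)) ->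
    peval (interleave (scons z r) s') e <=
    peval (interleave (scons y r) (fun=> u)) e.
  move=> he; apply: peval_mono => i hi; rewrite /interleave; case: odd.
    by apply: su; apply: leq_ltn_trans (half_le i) (he i hi).
  by case: i./2 => //=; exact: ltnW.
have [bp bq] := peval_le_ball_bound r y u p q.
have hp : peval (interleave (scons z r) s') p < d.
  apply: leq_ltn_trans Nd; apply: leq_trans bp; apply: hle => i hi.
  by rewrite leq_max hi.
have hq : peval (interleave (scons z r) s') q < d.
  apply: leq_ltn_trans Nd; apply: leq_trans bq; apply: hle => i hi.
  by rewrite leq_max hi orbT.
by have := eqmod_dvd dM hpq; rewrite !hmod !modn_small.
Qed.

Lemma dfun_ren (g : nat -> nat) f : dfun f -> dfun (fun r => f (fun i => r (g i))).
Proof. exact: (@dio_ren (fun i => if i is j.+1 then (g j).+1 else 0)). Qed.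

Lemma dfun_peval (F : nat -> env -> nat) p : (forall i, dfun (F i)) ->
  dfun (fun r => peval (fun i => F i r) p).
Proof. by move=> hF; elim: p => //= *; dioR. Qed.

Lemma dfun_peval_interleave (f : env -> nat) (g : nat -> nat) (h : nat -> env -> nat) p :
  dfun f -> (forall i, dfun (h i)) ->
  dfun (fun r => peval (interleave (scons (f r) (fun i => r (g i))) (fun i => h i r)) p).
Proof.
move=> hf hh; apply: dfun_peval => i; rewrite /interleave.
by case: odd => //; case: i./2 => //= j; exact: dfun_var.
Qed.

Ltac dio_more ::=
  match goal with
  | |- dio (fun r => is_true (_ <= _)) => apply: dio_le
  | |- dio (fun r => is_true (_ %| _)) => apply: dio_dvdn
  | |- dio (fun r => _ = _ %[mod _]) => apply: dio_eqmod
  | |- dfun (fun r => _ %/ _) => apply: dfun_divn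
  | |- dfun (fun r => _ %% _) => apply: dfun_modn
  | |- dfun (fun r => _`!) => apply: dfun_fact
  | |- dfun (fun r => _ ^_ _) => apply: dfun_ffact
  | |- dfun (fun r => \prod_(i < _) _) => apply: dfun_prod_beta_mod
  | |- dfun (fun r => beta_mod _ _) => apply: dfun_succ
  | |- dfun (fun r => peval (interleave _ _) _) => apply: dfun_peval_interleave => [|?]
  end.

Lemma dio_ball R f : dio (fun r => R (r 0) (behd r)) -> dfun f ->
  dio (fun r => forall z, z < f r -> R z r).
Proof.
move=> [p [q hR]] hf.
apply: (@dio_ext (fun r => exists s, ball_system r (f r) p q s)) => [r|].
  split=> [[s hs] z zy|h].
    by apply/(hR (scons z r)); exact: ball_system_sound hs z zy.
  by apply: ball_system_complete => z zy; apply/hR; exact: h.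
(* The system becomes a relation on one environment [w], the form that [dio_exs] takes. *)
apply: (@dio_ext (fun r => exists s, let w := interleave r s in
   ball_system (fun i => w i.*2) (f (fun i => w i.*2)) p q (fun i => w i.*2.+1))).
  move=> r; split=> -[s]; rewrite /= ?interleave_evens ?interleave_odds => hs;
  by exists s; rewrite /= ?interleave_evens ?interleave_odds.
apply: (dio_exs (R := fun w => ball_system (fun i => w i.*2)
  (f (fun i => w i.*2)) p q (fun i => w i.*2.+1))).
have hf' := @dfun_ren double _ hf.
rewrite /ball_system /ball_bound.
apply: dio_and; first by dioR.
apply: dio_and; first by dioR.
apply: dio_and; first by dioR.
apply: dio_and; last by dioR.
by apply: dio_all => i; dioR.
Qed.

(** * Graphs of recursive functions *)

(** The anonymous fixpoint in [computes], named so that [computes_PrimRec] holds by conversion. *)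
Definition prim_rel (F : nat -> Prop) (G : nat -> nat -> nat -> Prop) :=
  fix rec k y := match k with
  | 0 => F y
  | k'.+1 => exists z, rec k' z /\ G k' z y
  end.

Definition beta c t i := c %% beta_mod t i.

Lemma beta_exists S k : exists c t, forall i, i <= k -> beta c t i = S i.
Proof.
(* The summand [k] makes the moduli coprime; the maximum keeps each value below its modulus. *)
pose N := k + \max_(i < k.+1) S i.
exists (crt (beta_mod N`!) S k.+1), N`! => i ik.
rewrite /beta crtP ?ltnS //; last by apply: (@beta_mod_coprime N); rewrite // /N; lia.
rewrite modn_small // /beta_mod ltnS (leq_trans _ (leq_pmull _ _)) //.
apply: leq_trans (fact_geq N); apply: leq_trans (leq_addl _ _).
exact: (leq_bigmax (F := fun i : 'I_k.+1 => S i) (Ordinal (ik : i < k.+1))).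
Qed.

(** The list of intermediate values is coded by two numbers, so recursion becomes a bounded
    universal quantifier over its steps. *)
Lemma prim_relP F G k y : prim_rel F G k y <->
  exists c t, F (beta c t 0) /\ y = beta c t k /\
    forall i, i < k -> G i (beta c t i) (beta c t i.+1).
Proof.
split=> [h|[c [t [h0 [-> hG]]]]].
  suff [S [h0 [hk hS]]] : exists S : env, F (S 0) /\ S k = y /\
      forall i, i < k -> G i (S i) (S i.+1).
    have [c [t hct]] := beta_exists S k; exists c, t.
    split; first by rewrite hct.
    split; first by rewrite hct.
    by move=> i ik; rewrite !hct ?(ltnW ik) //; exact: hS.
  elim: k y h => [|k IH] y /=; first by exists (fun=> y).
  case=> z [/IH[S [h0 [hk hS]]] hG].
  exists (fun i => if i <= k then S i else y); rewrite ltnn; split=> //; split=> // i.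
  move=> ik; have [e|{}ik] : i = k \/ i < k by lia.
    by rewrite e leqnn ltnn hk.
  by rewrite (ltnW ik) ik; exact: hS.
have {hG} : forall i, i <= k -> prim_rel F G i (beta c t i).
  elim=> [|i IH] ik //; exists (beta c t i); split; first exact/IH/ltnW.
  exact: hG.
exact.
Qed.

Lemma dfun_beta f g h : dfun f -> dfun g -> dfun h ->
  dfun (fun r => beta (f r) (g r) (h r)).
Proof. by rewrite /beta /beta_mod => *; dioR. Qed.

Lemma dio_scons (R : nat -> env -> Prop) f (F : nat -> env -> nat) :
  dio (fun r => R (r 0) (behd r)) -> dfun f -> (forall i, dfun (F i)) ->
  dio (fun r => R (f r) (fun i => F i r)).
Proof.
move=> hR hf hF.
by apply: (@dio_subst _ (fun i r => if i is j.+1 then F j r else f r) hR) => -[|i].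
Qed.

Lemma dio_prim_rel (F : nat -> env -> Prop) (G : nat -> nat -> nat -> env -> Prop) f g :
  dio (fun r => F (r 0) (behd r)) ->
  dio (fun r => G (r 0) (r 1) (r 2) (behd (behd (behd r)))) ->
  dfun f -> dfun g ->
  dio (fun r => prim_rel (fun y => F y r) (fun k z y => G k z y r) (f r) (g r)).
Proof.
move=> hF hG hf hg.
apply: (dio_ext (fun r => iff_sym (prim_relP _ _ _ _))).
have hf2 := dfun_behd (dfun_behd hf); have hg2 := dfun_behd (dfun_behd hg).
apply: dio_ex; apply: dio_ex.
apply: dio_and.
  apply: (dio_scons hF) => [|i]; last exact: (dfun_var i.+2).
  by apply: dfun_beta; dioR.
apply: dio_and; first by apply: dio_eq => //; apply: dfun_beta; dioR.
apply: (dio_ball (R := fun i r => G i (beta (r 1) (r 0) i) (beta (r 1) (r 0) i.+1)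
  (behd (behd r)))) => //.
apply: (@dio_subst _ (fun i r => match i with
  | 0 => r 0 | 1 => beta (r 2) (r 1) (r 0) | 2 => beta (r 2) (r 1) (r 0).+1
  | j.+3 => r j.+3 end) hG).
by case=> [|[|[|i]]]; [|apply: dfun_beta|apply: dfun_beta|]; dioR.
Qed.

Definition vec n (r : env) : n.-tuple nat := [tuple r i | i < n].

Lemma vec_scons n x r : [tuple of x :: vec n r] = vec n.+1 (scons x r).
Proof.
apply: eq_from_tnth => i; rewrite tnth_mktuple.
case: (unliftP ord0 i) => [j ->|->]; last by rewrite tnth0.
by rewrite tnthS tnth_mktuple.
Qed.

Lemma thead_vec n r : thead (vec n.+1 r) = r 0.
Proof. by rewrite /thead tnth_mktuple. Qed.

Lemma behead_vec n r : behead_tuple (vec n.+1 r) = vec n (behd r).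
Proof.
apply: eq_from_tnth => i; rewrite tnth_behead !tnth_mktuple /behd.
by rewrite /= inordK // ltnS.
Qed.

Lemma dio_all_ord m (P : 'I_m -> env -> Prop) : (forall i, dio (P i)) ->
  dio (fun r => forall i, P i r).
Proof.
move=> hP.
apply: (@dio_ext (fun r => forall i, i < m -> forall h : i < m, P (Ordinal h) r)).
  move=> r; split=> [h i|h i _ hi]; last exact: h.
  have -> : i = Ordinal (ltn_ord i) by apply: val_inj.
  exact: h.
apply: dio_all => i.
have [hi|hi] : i < m \/ ~ i < m by case: (i < m); [left|right].
  apply: dio_ext (hP (Ordinal hi)) => r.
  by split=> [h h1|]; [rewrite (bool_irrelevance h1 hi)|apply].
by apply: dio_ext dio_true => r; split.
Qed.

Lemma computes_PrimRec n (f : recfun n) g v y :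
  computes (PrimRec f g) v y = prim_rel (computes f (behead_tuple v))
    (fun k z => computes g [tuple of k :: z :: (behead_tuple v : n.-tuple nat)])
    (thead v) y.
Proof. by []. Qed.

Theorem dio_computes n (f : recfun n) :
  dio (fun r => computes f (vec n (behd r)) (r 0)).
Proof.
elim: f => [{}n||{}n i|m {}n f IHf g IHg|{}n f IHf g IHg|{}n f IHf].
- by rewrite /=; dioR.
- by apply: (@dio_ext (fun r => r 0 = (r 1).+1)); [move=> r; rewrite /= thead_vec|dioR].
- by apply: (@dio_ext (fun r => r 0 = r i.+1)); [move=> r; rewrite /= tnth_mktuple|dioR].
(* The tuple of intermediate results is taken as the block of unknowns [s]. *)
- apply: (@dio_ext (fun r => exists s, let w := interleave r s in
    (forall i : 'I_m, computes (g i) (vec n (behd (fun j => w j.*2))) (w i.*2.+1)) /\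
    computes f (vec m (fun j => w j.*2.+1)) (w 0))).
    move=> r; split=> [[s /=]|[w [h1 h2]]].
      rewrite interleave_evens interleave_odds => -[h1 h2].
      exists (vec m s); split=> // i; rewrite tnth_mktuple.
      by have := h1 i; rewrite interleave_odd.
    exists (fun i => nth 0 w i); rewrite /= interleave_evens interleave_odds; split.
      by move=> i; rewrite interleave_odd -tnth_nth; exact: h1.
    have -> // : vec m (nth 0 w) = w.
    by apply: eq_from_tnth => i; rewrite tnth_mktuple (tnth_nth 0).
  apply: (dio_exs (R := fun w =>
    (forall i : 'I_m, computes (g i) (vec n (behd (fun j => w j.*2))) (w i.*2.+1)) /\
    computes f (vec m (fun j => w j.*2.+1)) (w 0))).
  apply: dio_and.
    apply: dio_all_ord => i.
    apply: (dio_scons (R := fun y r => computes (g i) (vec n r) y)) => // [|j];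
    by dioR.
  by apply: (dio_scons (R := fun y r => computes f (vec m r) y)) => // [|j]; dioR.
(* Entry 0 is the value, entry 1 the recursion argument, and the parameters follow. *)
- apply: (@dio_ext (fun r => prim_rel (fun y => computes f (vec n (behd (behd r))) y)
    (fun k z y => computes g (vec n.+2 (scons k (scons z (behd (behd r))))) y)
    (r 1) (r 0))).
    move=> r; rewrite computes_PrimRec thead_vec behead_vec.
    rewrite -[behd r 0]/(r 1); elim: (r 1) (r 0) => [|k IH] y //=.
    by split=> -[z [h1 h2]]; exists z; split; try exact/IH; move: h2;
       rewrite -!vec_scons.
  apply: (@dio_prim_rel (fun y r => computes f (vec n (behd (behd r))) y)
    (fun k z y r => computes g (vec n.+2 (scons k (scons z (behd (behd r))))) y));
    try by dioR.
    by apply: (dio_scons (R := fun y r => computes f (vec n r) y)) => // [|j]; dioR.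
  apply: (dio_scons (R := fun y r => computes g (vec n.+2 r) y)) => // [|j].
    by dioR.
  by case: j => [|[|j]] /=; dioR.
- apply: dio_and.
    apply: (@dio_ext (fun r => computes f (vec n.+1 (scons (r 0) (behd r))) 0)).
      by move=> r; rewrite -vec_scons.
    apply: (dio_scons (R := fun y r => computes f (vec n.+1 r) y)) => // [|j].
      by dioR.
    by case: j => [|j] /=; dioR.
  apply: (@dio_ext (fun r => forall z, z < r 0 -> exists k,
      computes f (vec n.+1 (scons z (behd r))) k.+1)).
    move=> r; split=> h z /h[k hk]; exists k; move: hk; rewrite -vec_scons //.
  apply: (dio_ball (R := fun z r => exists k,
    computes f (vec n.+1 (scons z (behd r))) k.+1)); last by dioR.
  apply: dio_ex.
  apply: (dio_scons (R := fun y r => computes f (vec n.+1 r) y)) => // [|j].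
    by dioR.
  by case: j => [|j] /=; dioR.
Qed.

Lemma computes_fun n (f : recfun n) v y y' :
  computes f v y -> computes f v y' -> y = y'.
Proof.
elim: f v y y' => [{}n||{}n i|m {}n f IHf g IHg|{}n f IHf g IHg|{}n f IHf] v y y' /=.
- by move=> -> ->.
- by move=> -> ->.
- by move=> -> ->.
- move=> [w [hw hy]] [w' [hw' hy']].
  have e : w = w' by apply: eq_from_tnth => i; apply: IHg (hw i) (hw' i).
  by rewrite e in hy; apply: IHf hy hy'.
- elim: (thead v) y y' => [|k IH] y y'; first exact: IHf.
  by move=> [z [hz hy]] [z' [/(IH _ _ hz) <- hy']]; apply: IHg hy hy'.
- move=> [h0 hlt] [h0' hlt']; case: (ltngtP y y') => // h.
  + by have [k hk] := hlt' _ h; have := IHf _ _ _ h0 hk.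
  + by have [k hk] := hlt _ h; have := IHf _ _ _ h0' hk.
Qed.

(** * Arithmetic of the codes *)

Lemma pair_codeP x y z :
  z = pair_code x y <-> z * 2 = y * 2 + (x + y) * (x + y).+1.
Proof.
have := Cantor.to_nat_spec x y; rewrite /pair_code => h.
by split=> [->|h']; lia.
Qed.

Lemma dfun_pair_code f g : dfun f -> dfun g -> dfun (fun r => pair_code (f r) (g r)).
Proof.
apply: (@dfun_app2 pair_code).
apply: (dio_ext (fun r => iff_sym (pair_codeP (r 1) (r 2) (r 0)))).
by dioR.
Qed.

(** This codes the numeral [a^k] with [k] variable, whence the detour through primitive
    recursion. *)
Lemma dfun_seq_code_nseq c f : dfun f -> dfun (fun r => seq_code (nseq (f r) c)).
Proof.
apply: (@dfun_app1 (fun k => seq_code (nseq k c))).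
apply: (@dio_ext (fun r => prim_rel (fun y => y = 0)
  (fun _ z y => y = (pair_code c z).+1) (r 1) (r 0))).
  move=> r; elim: (r 1) (r 0) => //= k IH y; split.
    by move=> [z [/IH -> ->]].
  by move=> ->; exists (seq_code (nseq k c)); split=> //; apply/IH.
apply: (@dio_prim_rel (fun y _ => y = 0) (fun _ z y _ => y = (pair_code c z).+1));
  try by dioR.
by dioR; apply: dfun_pair_code; dioR.
Qed.

(** * Arithmetic in words *)

(** Euclid's algorithm on words: the shorter word is a prefix of the longer one, and commutes with
    what remains after removing it. *)
Lemma commute_count (A : eqType) (w u : seq A) c : w ++ u = u ++ w ->
  count_mem c w * size u = count_mem c u * size w.
Proof.
have [n] := ubnP (size w + size u); elim: n w u => // n IH w u.
wlog wu : w u / size w <= size u => [H|] hn h.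
  have [|/ltnW] := leqP (size w) (size u); first by move=> hle; exact: H.
  by move=> hle; apply/esym; apply: H => //; rewrite addnC.
have eu : u = w ++ drop (size w) u.
  rewrite -{1}(cat_take_drop (size w) u); congr (_ ++ _).
  by have := congr1 (take (size w)) h; rewrite take_size_cat // takel_cat.
set v := drop _ _ in eu; rewrite eu in h *; rewrite eu size_cat in hn.
have [/size0nil->|w0] := posnP (size w); first by rewrite /= muln0.
have {}h : w ++ v = v ++ w.
  by move: h; rewrite -catA => /(congr1 (drop (size w))); rewrite !drop_size_cat.
have := IH w v _ h; rewrite count_cat size_cat; move/(_ ltac:(lia)).
lia.
Qed.

Lemma commute_flatten_nseq T n (u : seq T) :
  flatten (nseq n u) ++ u = u ++ flatten (nseq n u).
Proof. by elim: n => [|n IH] /=; rewrite ?cats0 // -catA IH. Qed.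

Lemma count_flatten_nseq T (P : pred T) n u :
  count P (flatten (nseq n u)) = n * count P u.
Proof. by elim: n => //= n IH; rewrite count_cat IH mulSn. Qed.

Section Words.
Variables (A : finType) (a b : A).

Lemma extend_cat n (s : 'I_n -> seq A) u v :
  extend s (u ++ v) = extend s u ++ extend s v.
Proof. by rewrite /extend map_cat flatten_cat. Qed.

Lemma extend_const n (s : 'I_n -> seq A) k c :
  extend s (nseq k (inr c)) = nseq k c.
Proof. by elim: k => //= k; rewrite /extend /= => ->. Qed.

Lemma extend1 n (s : 'I_n -> seq A) i : extend s [:: inl i] = s i.
Proof. by rewrite /extend /= cats0. Qed.

(* The product of [|u|_a] and [|v|_a] is [|w|_a]: the word [x] has [|u|_a]
   letters [a] and no [b], [w] commutes with [x b] hence is essentially a power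
   [(x b)^m], and [y], which commutes with [a b], turns [m = |w|_b] into
   [|v|_a]. *)
Definition mul_formula n (w x y : 'I_n) (u v : term A n) : formula A n :=
  And (And (EqA [:: inl x] u) (EqB [:: inl x] [::]))
 (And (And (EqA [:: inl y] v)
           (WordEq [:: inl y; inr a; inr b] [:: inr a; inr b; inl y]))
      (And (WordEq [:: inl w; inl x; inr b] [:: inl x; inr b; inl w])
           (EqB [:: inl w] [:: inl y]))).

Variable N : nat.
(** [inord] has a default value beyond [N]; the bound [k + poly_vars p <= N.+1] keeps the numbering
    faithful. *)
Let var i : 'I_N.+1 := inord i.

Fixpoint poly_vars p :=
  match p with
  | PVar _ | PConst _ => 0
  | PAdd p q => poly_vars p + poly_vars q
  | PMul p q => poly_vars p + poly_vars q + 3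
  end.

(* The variable [x_i] denotes the number [|x_i|_a]; the auxiliary variables are
   numbered from [k]. *)
Fixpoint poly_term k p : term A N.+1 :=
  match p with
  | PVar i => [:: inl (var i)]
  | PConst c => nseq c (inr a)
  | PAdd p q => poly_term k p ++ poly_term (k + poly_vars p) q
  | PMul p q => [:: inl (var (k + (poly_vars p + poly_vars q)))]
  end.

Fixpoint poly_formula k p : formula A N.+1 :=
  match p with
  | PVar _ | PConst _ => WordEq [::] [::]
  | PAdd p q => And (poly_formula k p) (poly_formula (k + poly_vars p) q)
  | PMul p q =>
      let l := k + (poly_vars p + poly_vars q) in
      And (And (poly_formula k p) (poly_formula (k + poly_vars p) q))
        (mul_formula (var l) (var l.+1) (var l.+2)
           (poly_term k p) (poly_term (k + poly_vars p) q))
  end.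

Definition agree k (s s' : 'I_N.+1 -> seq A) :=
  forall i : nat, i < k -> s (var i) = s' (var i).

(** Later choices of auxiliary variables therefore leave earlier subformulas satisfied. *)
Lemma poly_formula_local s s' k p : pbound p <= k -> agree (k + poly_vars p) s s' ->
  extend s (poly_term k p) = extend s' (poly_term k p) /\
  sat a b s (poly_formula k p) = sat a b s' (poly_formula k p).
Proof.
elim: p k => [i|c|p IHp q IHq|p IHp q IHq] k /= hk hs.
- by rewrite !extend1 hs // addn0.
- by rewrite !extend_const.
- have [|i hi|e1 f1] := IHp k; [lia|apply: hs; lia|].
  have [|i hi|e2 f2] := IHq (k + poly_vars p); [lia|apply: hs; lia|].
  by rewrite !extend_cat e1 e2 f1 f2.
- have [|i hi|e1 f1] := IHp k; [lia|apply: hs; lia|].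
  have [|i hi|e2 f2] := IHq (k + poly_vars p); [lia|apply: hs; lia|].
  rewrite /= /Defs.eq_count e1 e2 f1 f2 /extend /= !hs //; lia.
Qed.

Hypothesis hab : a != b.

Lemma count_ab : (count_mem a [:: a; b] = 1) * (count_mem b [:: a; b] = 1).
Proof. by rewrite /= !eqxx eq_sym (negPf hab). Qed.

Lemma mul_formula_sound n (s : 'I_n -> seq A) w x y u v :
  sat a b s (mul_formula w x y u v) ->
  count_mem a (s w) = count_mem a (extend s u) * count_mem a (extend s v).
Proof.
rewrite /mul_formula /= /Defs.eq_count !extend1 => /andP[/andP[/eqP xa /eqP xb]].
case/andP=> /andP[/eqP ya /eqP yab] /andP[/eqP wxb /eqP wy].
rewrite /extend /= !cats0 in yab wxb.
have hcy c := commute_count c (yab : s y ++ [:: a; b] = [:: a; b] ++ s y).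
have hcw c : count_mem c (s w) * size (s x ++ [:: b]) =
    count_mem c (s x ++ [:: b]) * size (s w).
  by apply: commute_count; rewrite -catA.
(* Cancelling 2 gives [|y|_b = |y|_a]. Cancelling [|x| + 1] gives [|w|_a = |x|_a |w|_b], whatever
   other letters [x] contains. *)
have := hcy a; have := hcy b; have := hcw a; have := hcw b; rewrite !count_ab.
rewrite !count_cat !size_cat /= eqxx (negPf (_ : b != a)) 1?eq_sym // xa xb wy ya /=.
move=> h1 h2 h3 h4; have {}h3 : count_mem b (s y) = count_mem a (extend s v).
  by apply/eqP; rewrite -(@eqn_pmul2r 2) // h3 h4.
rewrite h3 in h1; apply/eqP; rewrite -(@eqn_pmul2r (size (s x) + 1)) ?addn1 //.
by apply/eqP; rewrite -addn1 h2 !addn0 -mulnA h1 !addn0 mul1n.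
Qed.

Lemma mul_formula_complete n (s : 'I_n -> seq A) w x y u v k m :
  count_mem a (extend s u) = k -> count_mem a (extend s v) = m ->
  s x = nseq k a -> s y = flatten (nseq m [:: a; b]) ->
  s w = flatten (nseq m (rcons (nseq k a) b)) ->
  sat a b s (mul_formula w x y u v).
Proof.
move=> hu hv hx hy hw.
rewrite /mul_formula /= /Defs.eq_count !extend1 hu hv hx hy hw.
rewrite !count_flatten_nseq !count_ab -cats1 count_cat !count_nseq /= eqxx.
rewrite (negPf hab) mul0n mul1n muln1 !eqxx /= muln1 eqxx andbT.
rewrite /extend /= !cats0 hx hy hw commute_flatten_nseq eqxx /=.
by rewrite -cats1 commute_flatten_nseq -catA.
Qed.

Lemma poly_formula_sound s k p : sat a b s (poly_formula k p) ->
  count_mem a (extend s (poly_term k p)) = peval (fun i => count_mem a (s (var i))) p.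
Proof.
elim: p k => [i|c|p IHp q IHq|p IHp q IHq] k.
- by rewrite extend1.
- by move=> _; rewrite extend_const count_nseq /= eqxx mul1n.
- by move=> /andP[/IHp hp /IHq hq]; rewrite extend_cat count_cat hp hq.
- move=> /andP[/andP[/IHp hp /IHq hq] /mul_formula_sound].
  by rewrite hp hq extend1.
Qed.

Lemma poly_formula_complete s k p : pbound p <= k -> k + poly_vars p <= N.+1 ->
  exists s', agree k s s' /\ sat a b s' (poly_formula k p).
Proof.
elim: p s k => [i|c|p IHp q IHq|p IHp q IHq] s k /= hk hN; try by exists s.
- have [||s1 [h1 f1]] := IHp s k; [lia|lia|].
  have [||s2 [h2 f2]] := IHq s1 (k + poly_vars p); [lia|lia|].
  exists s2; split=> [i hi|]; first by rewrite h1 // h2 //; lia.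
  by rewrite f2 andbT -(proj2 (@poly_formula_local s1 s2 k p _ h2)) //; lia.
- have [||s1 [h1 f1]] := IHp s k; [lia|lia|].
  have [||s2 [h2 f2]] := IHq s1 (k + poly_vars p); [lia|lia|].
  set l := k + (poly_vars p + poly_vars q).
  set m1 := count_mem a (extend s2 (poly_term k p)).
  set m2 := count_mem a (extend s2 (poly_term (k + poly_vars p) q)).
  (* The three new variables receive [(a^m1 b)^m2], [a^m1] and [(a b)^m2]. *)
  pose s3 (i : 'I_N.+1) := if val i == l then flatten (nseq m2 (rcons (nseq m1 a) b))
    else if val i == l.+1 then nseq m1 a
    else if val i == l.+2 then flatten (nseq m2 [:: a; b]) else s2 i.
  have vE i : i < N.+1 -> val (var i) = i by exact: inordK.
  have h3 : agree l s2 s3.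
    move=> i hi; rewrite /s3 vE; last by rewrite /l in hi; lia.
    by rewrite !ltn_eqF // ltnW // ltnW.
  have h1' : agree (k + poly_vars p) s1 s3.
    by move=> i hi; rewrite h2 // h3 //; rewrite /l; lia.
  have [||e1 f1'] := @poly_formula_local s2 s3 k p; [lia| |].
    by move=> i hi; rewrite h3 //; rewrite /l; lia.
  have [||e2 f2'] := @poly_formula_local s2 s3 (k + poly_vars p) q; [lia| |].
    by move=> i hi; rewrite h3 //; rewrite /l; lia.
  exists s3; split=> [i hi|]; first by rewrite h1 // h1' //; lia.
  rewrite -f1' -f2' f2 -(proj2 (@poly_formula_local s1 s2 k p _ h2)) ?f1; last by lia.
  apply: (@mul_formula_complete _ _ _ _ _ _ _ m1 m2); rewrite -?e1 -?e2 //.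
  + by rewrite /s3 vE ?eqxx ?gtn_eqF ?ltnSn //; rewrite /l; lia.
  + by rewrite /s3 vE ?eqxx ?gtn_eqF ?ltnSn //; rewrite /l; lia.
  + by rewrite /s3 vE ?eqxx //; rewrite /l; lia.
Qed.

End Words.

(** * The diagonal sentence *)

Section Diagonal.
Variables (A : finType) (a b : A).
Hypothesis hab : a != b.

(* [x_0] and [x_2] carry the two arguments: parameters have even indices in
   [interleave]. *)
Definition instance N (phi : formula A N.+1) x y : sentence A :=
  Sentence (And (And (EqA [:: inl (inord 0)] (nseq x (inr a)))
                     (EqA [:: inl (inord 2)] (nseq y (inr a)))) phi).

Lemma dio_holds (Q : nat -> nat -> Prop) : dio (fun r => Q (r 0) (r 1)) ->
  exists N (phi : formula A N.+1), 1 < N /\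
    forall x y, Q x y <-> holds a b (instance phi x y).
Proof.
(* Auxiliary variables start at [V], above those of both polynomials and above [x_2]. *)
move=> [p [q hQ]]; pose V := maxn 3 (maxn (pbound p) (pbound q)).
pose V' := V + poly_vars p; pose N := V' + poly_vars q.
exists N, (And (And (poly_formula a b N V p) (poly_formula a b N V' q))
               (EqA (poly_term a N V p) (poly_term a N V' q))).
have V3 : 3 <= V by rewrite leq_maxl.
have pV : pbound p <= V by rewrite /V; lia.
have qV : pbound q <= V by rewrite /V; lia.
have VN : V <= N by rewrite /N /V' -addnA leq_addr.
split; first by lia.
move=> x y; rewrite /holds /=; split.
  pose r := scons x (scons y (fun=> 0)).
  move=> /(hQ r)[s hs].
  have [||s1 [h1 f1]] := @poly_formula_complete _ a b N hab
    (fun i => nseq (interleave r s i) a) V p; [lia|by rewrite /N /V'; lia|].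
  have [||s2 [h2 f2]] := @poly_formula_complete _ a b N hab s1 V' q.
  - by rewrite /V'; lia.
  - by rewrite /N; lia.
  have {}f1 : sat a b s2 (poly_formula a b N V p).
    by rewrite -(proj2 (poly_formula_local a b pV h2)).
  have hval i : i < V -> count_mem a (s2 (inord i)) = interleave r s i.
    move=> iV; rewrite -h2; last by rewrite /V'; lia.
    by rewrite -h1 // count_nseq /= eqxx mul1n inordK // ltnS; lia.
  exists s2; rewrite /= /Defs.eq_count !extend1 !extend_const f1 f2 !count_nseq.
  rewrite !hval //; last by lia.
  rewrite /= eqxx !mul1n /interleave /= !eqxx /=.
  rewrite (poly_formula_sound hab f1) (poly_formula_sound hab f2).
  rewrite (@peval_bound _ (interleave r s) p); last by move=> i hi; apply: hval; lia.
  rewrite (@peval_bound _ (interleave r s) q); last by move=> i hi; apply: hval; lia.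
  by rewrite hs.
move=> [s /andP[/andP[hx hy] /andP[/andP[f1 f2] f3]]].
move: hx hy f3; rewrite /Defs.eq_count !extend1 !extend_const !count_nseq /= eqxx !mul1n.
rewrite (poly_formula_sound hab f1) (poly_formula_sound hab f2).
(* The letter counts of a satisfying assignment solve the equation. *)
set v := fun i => count_mem a (s (inord i)) => /eqP hx /eqP hy /eqP hv.
rewrite -hx -hy; apply/(hQ (fun i => v i.*2)); exists (fun i => v i.*2.+1).
suff -> : interleave (fun i => v i.*2) (fun i => v i.*2.+1) = v by [].
apply: functional_extensionality => i; rewrite /interleave.
by rewrite -[in RHS](odd_double_half i); case: odd.
Qed.

(** [sentence_code] of an instance as a total function of numbers: 4 and 1 are the tags of [And] and
    [EqA], and [n] is both the number of variables and the first numeral. *)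
Definition instance_code n e : nat :=
  let num i k := pair_code 1 (pair_code (seq_code [:: pair_code 0 i])
    (seq_code (nseq k (pair_code 1 (enum_rank a))))) in
  pair_code n (pair_code 4 (pair_code (pair_code 4
    (pair_code (num 0 n) (num 2 e))) e)).

Lemma instance_codeE N (phi : formula A N.+1) : 1 < N ->
  sentence_code (instance phi N.+1 (formula_code phi)) =
  instance_code N.+1 (formula_code phi).
Proof.
by move=> hN; rewrite /sentence_code /= /term_code !map_nseq /= map_nseq !inordK.
Qed.

Lemma dio_instance_code (D : recfun 1) :
  dio (fun r => computes D [tuple instance_code (r 0) (r 1)] 0).
Proof.
have h : dfun (fun r => instance_code (r 0) (r 1)).
  by do ![apply: dfun_pair_code | apply: dfun_seq_code_nseq | dio1].
apply: (@dio_ext (fun r => computes D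
  (vec 1 (fun i => instance_code (r 0) (r 1))) 0)).
  move=> r; suff -> : vec 1 (fun i => instance_code (r 0) (r 1)) =
    [tuple instance_code (r 0) (r 1)] by [].
  by apply: eq_from_tnth => i; rewrite tnth_mktuple (tnth_nth 0) (ord1 i).
by apply: (dio_scons (R := fun y r => computes D (vec 1 r) y)) (dio_computes D) _ _; dioR.
Qed.

End Diagonal.

Theorem corollary4p7 (A : finType) (a b : A) (hab : a != b) :
  ~ algorithmically_decidable (@sentence_code A) (holds a b).
Proof.
case=> D hD.
have [N [phi [hN hphi]]] := dio_holds hab
  (Q := fun n e => computes D [tuple instance_code a n e] 0) (dio_instance_code a D).
have := hphi N.+1 (formula_code phi); rewrite -instance_codeE //.
set Phi := instance _ _ _ _ => hPhi; have [h1 h0] := hD Phi.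
(* [Phi] holds exactly when [D] answers 0 on its code. If it held, [D] would answer both 1 and 0; as
   it fails, [D] answers 0, so it holds. *)
have nPhi : ~ holds a b Phi.
  by move=> h; have := computes_fun (h1 h) (proj2 hPhi h).
exact/nPhi/hPhi/h0.
Qed.
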